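(* Let $G$ be a finitely generated group and let $\sigma$ be an almost submultiplicative growth function. (i) The projective limit $\mathcal{A}_\sigma(G)=\bigcap_{R\ge0}\ell^1_{L,\sigma,R}(G)$ of the Banach spaces $\ell^1_{L,\sigma,R}(G)$ (as a subspace of $\mathbb{C}[[G]]$ and as a locally convex space) is independent of the chosen word length $L$. (ii) The group algebra $\mathbb{C}[G]$ is dense in $\mathcal{A}_\sigma(G)$ and all algebraic structures of $\mathbb{C}[G]$ (product, unit, $^*$-involution, antipode, counit, and the coproduct with values in the completed projective tensor product $\mathcal{A}_\sigma(G)\hat{\otimes}_\pi\mathcal{A}_\sigma(G)$) are continuous, yielding a Fréchet-Hopf $^*$-algebra structure on $\mathcal{A}_\sigma(G)$. (iii) If $\sigma$ is submultiplicative then $\mathcal{A}_\sigma(G)$ is a locally multiplicatively convex algebra: the norms $\|\cdot\|_{L,\sigma,R}$, $R\ge0$, are submultiplicative.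
   Context: For a finite generating set $S=S^{-1}$ of $G$ the word length $L(g)\in\mathbb{N}_0$ is the minimal number of elements of $S$ needed to write $g$ as a product, $L(e)=0$. A growth function is a map $\sigma\colon\mathbb{N}_0\to[1,\infty)$ that is monotonically increasing ($\sigma(n)\le\sigma(n+1)$) and unbounded. It is submultiplicative if $\sigma(n+m)\le\sigma(n)\sigma(m)$ for all $n,m$, and almost submultiplicative if for every $\epsilon>0$ there is $c>0$ with $\sigma(n+m)\le c\,\sigma(n)^{1+\epsilon}\sigma(m)^{1+\epsilon}$ for all $n,m\in\mathbb{N}_0$. $\mathbb{C}[[G]]$ is the space of all formal series $a=\sum_{g\in G}a_g\mathsf{e}_g$, $a_g\in\mathbb{C}$, and $\mathbb{C}[G]$ the subspace of finite sums. For $R\ge0$ put $\|a\|_{L,\sigma,R}=\sum_{g\in G}|a_g|\,\sigma(L(g))^R$ and $\ell^1_{L,\sigma,R}(G)=\{a\in\mathbb{C}[[G]]:\|a\|_{L,\sigma,R}<\infty\}$. $\mathcal{A}_\sigma(G)=\bigcap_{R\ge0}\ell^1_{L,\sigma,R}(G)$ carries the locally convex topology defined by all the norms $\|\cdot\|_{L,\sigma,R}$, $R\ge0$. $\mathbb{C}[G]$ is a cocommutative Hopf $^*$-algebra with product $\mathsf{e}_g\mathsf{e}_h=\mathsf{e}_{gh}$, unit $\mathsf{e}_e$, involution $a^*=\sum_g\overline{a_g}\mathsf{e}_{g^{-1}}$, antipode $S(a)=\sum_g a_g\mathsf{e}_{g^{-1}}$, counit $\epsilon(a)=\sum_g a_g$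 and coproduct $\Delta(a)=\sum_g a_g\,\mathsf{e}_g\otimes\mathsf{e}_g$. A Fréchet-Hopf $^*$-algebra is a Fréchet space with continuous structure maps of this kind satisfying the Hopf $^*$-algebra axioms, where the algebraic tensor product is replaced by the completed projective tensor product. *)

(* Defs.v *)
From HB Require Import structures.
From mathcomp Require Import all_boot all_order all_algebra.
From mathcomp Require Import sesquilinear complex.
From mathcomp Require Import all_classical all_reals all_analysis.
From mathcomp Require Import interval_inference.

Set Implicit Arguments.
Unset Strict Implicit.
Unset Printing Implicit Defensive.

Import Order.TTheory GRing.Theory Num.Theory.
Import numFieldNormedType.Exports.
Import ComplexField.Normc.

Local Open Scope classical_set_scope.
Local Open Scope ring_scope.

Lemma normc_ge0 (R : rcfType) (z : R[i]) : 0 <= normc z.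
Proof. by rewrite -lecR; exact: (normr_ge0 z). Qed.

Definition is_seminorm (R : realType) (E : lmodType R[i]) (p : E -> R) : Prop :=
  (forall x y, p (x + y) <= p x + p y) /\
  (forall k x, p (k *: x) = normc k * p x).

Section seminorm_theory.
Context (R : realType) (E : lmodType R[i]) (p : E -> R).
Hypothesis pP : is_seminorm p.

Lemma seminorm0 : p 0 = 0.
Proof. by rewrite -(scale0r (0 : E)) pP.2 normc0 mul0r. Qed.

Lemma seminormN x : p (- x) = p x.
Proof. by rewrite -scaleN1r pP.2 normcN normc1 mul1r. Qed.

Lemma seminormB x y : p (x - y) = p (y - x).
Proof. by rewrite -opprB seminormN. Qed.

Lemma seminorm_ge0 x : 0 <= p x.
Proof.
have := pP.1 x (- x); rewrite subrr seminorm0 seminormN => h.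
by rewrite -(pmulrn_lge0 (p x) (ltn0Sn 1)) mulr2n.
Qed.

End seminorm_theory.


Definition all_lt (R : realType) (E : lmodType R[i]) (I : Type)
    (p : I -> E -> R) (s : seq I) (e : R) : set E :=
  [set x | all (fun i => p i x < e) s].

Section all_lt_theory.
Context (R : realType) (E : lmodType R[i]) (I : Type) (p : I -> E -> R).
Hypothesis pP : forall i, is_seminorm (p i).
Implicit Types (s : seq I) (e d : R) (x y : E).

Lemma all_lt0 s e : 0 < e -> all_lt p s e 0.
Proof.
by move=> e0; rewrite /all_lt/=; elim: s => //= i s ->;
  rewrite (seminorm0 (pP i)) e0.
Qed.

Lemma all_ltD s e d x y :
  all_lt p s e x -> all_lt p s d y -> all_lt p s (e + d) (x + y).
Proof.
rewrite /all_lt/=; elim: s => //= i s ih /andP[xe xs] /andP[yd ys].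
by rewrite ih// andbT (le_lt_trans ((pP i).1 x y))// ltrD.
Qed.

Lemma all_ltZ s e (k : R[i]) (M : R) x : 0 < e -> 0 < M -> normc k <= M ->
  all_lt p s e x -> all_lt p s (M * e) (k *: x).
Proof.
move=> e0 M0 kM; rewrite /all_lt/=; elim: s => //= i s ih /andP[xe xs].
rewrite ih// andbT (pP i).2.
rewrite (@le_lt_trans _ _ (M * p i x))// ?ltr_pM2l//.
by rewrite ler_wpM2r// (seminorm_ge0 (pP i)).
Qed.

Lemma all_ltW s e d x : e <= d -> all_lt p s e x -> all_lt p s d x.
Proof.
move=> ed; rewrite /all_lt/=; elim: s => //= i s ih /andP[xe xs].
by rewrite ih// andbT (lt_le_trans xe).
Qed.

Lemma all_lt_cat s t e x :
  all_lt p (s ++ t) e x <-> all_lt p s e x /\ all_lt p t e x.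
Proof. by rewrite /all_lt/= all_cat; split => [/andP|] // [-> ->]. Qed.

Lemma all_lt_ex s x : exists2 e, 0 < e & all_lt p s e x.
Proof.
rewrite /all_lt/=; elim: s => [|i s [e e0 xs]] /=; first by exists 1.
exists (Num.max e (p i x + 1)); first by rewrite lt_max e0.
rewrite lt_max ltrDl ltr01 orbT/=.
by apply: (@all_ltW s e) => //; rewrite le_max lexx.
Qed.

Lemma all_lt_slack s e x : 0 < e -> all_lt p s e x ->
  exists2 d, 0 < d & all_lt p s (e - d) x.
Proof.
move=> e0; rewrite /all_lt/=; elim: s => [|i s ih] /=; first by exists e.
move=> /andP[xe /ih[d d0 xs]].
exists (Num.min d ((e - p i x) / 2)).
  by rewrite lt_min d0 divr_gt0// subr_gt0.
apply/andP; split.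
  rewrite ltrBrDr -ltrBrDl (@le_lt_trans _ _ ((e - p i x) / 2))// ?ge_min ?lexx ?orbT//.
  by rewrite ltr_pdivrMr// mulr2n mulrDr mulr1 ltrDr subr_gt0.
by apply: (@all_ltW s (e - d)) => //; rewrite lerD2l lerN2 ge_min lexx.
Qed.

End all_lt_theory.

HB.factory Record Seminorms_isTvs (R : realType) (E : Type)
    of GRing.Lmodule R[i] E := {
  index : Type ;
  seminorms : index -> E -> R ;
  seminormsP : forall i, is_seminorm (seminorms i)
}.

HB.builders Context R E of Seminorms_isTvs R E.

Definition seminorm_nbhs (x : E) : set_system E :=
  [set U | exists s e, 0 < e /\ forall y, all_lt seminorms s e (y - x) -> U y].

#[warning="-HB.no-new-instance"]
HB.instance Definition _ := hasNbhs.Build E seminorm_nbhs.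

Let nbhs_filter (x : E) : ProperFilter (nbhs x).
Proof.
split.
  move=> [s [e [e0 /(_ x)]]]; apply; rewrite subrr.
  exact: all_lt0 seminormsP _ _ e0.
split.
- by exists [::], 1; split.
- move=> U V [s [e [e0 sU]]] [t [d [d0 tV]]].
  exists (s ++ t), (Num.min e d); split; first by rewrite lt_min e0.
  move=> y /all_lt_cat[ys yt]; split.
    by apply: sU; apply: all_ltW ys; rewrite ge_min lexx.
  by apply: tV; apply: all_ltW yt; rewrite ge_min lexx orbT.
- by move=> U V UV [s [e [e0 sU]]]; exists s, e; split => // y /sU/UV.
Qed.

Let nbhs_singleton (x : E) (U : set E) : nbhs x U -> U x.
Proof.
move=> [s [e [e0]]]; apply; rewrite subrr.
exact: all_lt0 seminormsP _ _ e0.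
Qed.

Let nbhs_nbhs (x : E) (U : set E) : nbhs x U -> nbhs x (nbhs^~ U).
Proof.
move=> [s [e [e0 sU]]]; exists s, (e / 2); split; first by rewrite divr_gt0.
move=> y yx; exists s, (e / 2); split; first by rewrite divr_gt0.
move=> z zy; apply: sU; rewrite -(subrK y z) -addrA (splitr e).
exact: (all_ltD seminormsP zy yx).
Qed.

#[warning="-HB.no-new-instance"]
HB.instance Definition _ := Nbhs_isNbhsTopological.Build E
  nbhs_filter nbhs_singleton nbhs_nbhs.

Let add_continuous : continuous (fun x : E * E => x.1 + x.2).
Proof.
move=> [x y] U /= [s [e [e0 sU]]].
have e20 : (0 : R) < e / 2 by rewrite divr_gt0.
exists ([set z | all_lt seminorms s (e / 2) (z - x)],
        [set z | all_lt seminorms s (e / 2) (z - y)]) => /=.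
  by split; exists s, (e / 2).
move=> [u v] /= [ux vy]; apply: sU; rewrite opprD addrACA (splitr e).
exact: (all_ltD seminormsP ux vy).
Qed.

Let scale_continuous : continuous (fun z : R[i]^o * E => z.1 *: z.2).
Proof.
move=> [k x] U /= [s [e [e0 sU]]].
have [M M0 xM] := all_lt_ex seminorms s x.
pose N := normc k + 1.
have N0 : 0 < N by rewrite ltr_wpDl// normc_ge0.
pose d := Num.min 1 (e / 2 / M).
have d0 : 0 < d by rewrite lt_min ltr01 !divr_gt0.
exists ([set l : R[i]^o | normc (k - l) < d],
        [set z | all_lt seminorms s (e / 2 / N) (z - x)]) => /=.
  split; last by exists s, (e / 2 / N); split => //; rewrite !divr_gt0.
  exists d%:C%C; first by rewrite /= ltcR.
  by move=> l /=; rewrite -[ltLHS]/((normc (k - l))%:C%C) ltcR.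
move=> [l z] /= [lk zx]; apply: sU.
have -> : l *: z - k *: x = l *: (z - x) + (l - k) *: x.
  by rewrite scalerBr scalerBl addrA subrK.
have lN : normc l <= N.
  rewrite -(subrK k l) (le_trans (le_normcD _ _))// addrC lerD2l.
  rewrite -normcN opprB (ltW (lt_le_trans lk _))// ge_min lexx //.
rewrite (splitr e); apply: (all_ltD seminormsP).
  by rewrite -{1}(mulfVK (lt0r_neq0 N0) (e / 2)) mulrC;
    apply: (all_ltZ seminormsP) => //; rewrite !divr_gt0.
have -> : e / 2 = (e / 2 / M) * M by rewrite mulfVK// gt_eqF.
apply: (all_ltZ seminormsP) => //; first by rewrite !divr_gt0.
by rewrite -normcN opprB (ltW (lt_le_trans lk _))// ge_min lexx orbT.
Qed.

Local Open Scope convex_scope.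

Let locally_convex : exists2 B : set_system E,
  (forall b, b \in B -> convex_set b) & basis B.
Proof.
exists [set B | exists x s e, 0 < e /\
    B = [set y | all_lt seminorms s e (y - x)]].
  move=> B /[!inE] -[x [s [e [e0 ->]]]]; apply/convex_setW => y z.
  rewrite !inE/= => yx zx k k0 k1; rewrite inE/=.
  have -> : (y : convex_lmodType E) <| k |> z - x =
      k%:num *: (y - x) + (1 - k%:num) *: (z - x).
    rewrite !scalerBr [RHS]addrACA -opprD -scalerDl addrCA subrr addr0 scale1r.
    by [].
  have nk (c : R[i]) : 0 <= c -> (normc c)%:C%C = c by move/ger0_norm.
  have n1 : normc k%:num + normc (1 - k%:num) = 1.
    apply: complexI; rewrite rmorphD/= !nk ?subr_ge0 ?(ltW k1) ?(ltW k0)//.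
    by rewrite addrC subrK.
  have npos (c : R[i]) : 0 < c -> 0 < normc c.
    by move=> c0; rewrite -ltcR nk// ltW.
  rewrite -[e]mul1r -n1 mulrDl; apply: (all_ltD seminormsP).
    by apply: (all_ltZ seminormsP) => //; rewrite npos.
  by apply: (all_ltZ seminormsP) => //; rewrite npos// subr_gt0.
split.
  move=> _ [x [s [e [e0 ->]]]]; rewrite openE => y /= yx.
  have [d d0 yd] := all_lt_slack e0 yx.
  exists s, d; split => // z zy /=.
  rewrite -(subrK y z) -addrA -(subrK d e) [e - d + d]addrC.
  exact: (all_ltD seminormsP zy yd).
move=> x U [s [e [e0 sU]]].
exists [set y | all_lt seminorms s e (y - x)]; last exact: sU.
split; first by exists x, s, e; split.
by rewrite /= subrr; exact: (all_lt0 seminormsP).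
Qed.

HB.instance Definition _ := PreTopologicalLmod_isTvs.Build R[i] E
  add_continuous scale_continuous locally_convex.

(* [PreTopologicalLmod_isTvs] only provides the uniform structure. *)
HB.instance Definition _ := PreTopologicalNmodule_isTopologicalNmodule.Build E
  add_continuous.
HB.instance Definition _ := TopologicalNmodule_isTopologicalLmodule.Build R[i] E
  scale_continuous.
HB.instance Definition _ := Uniform_isTvs.Build R[i] E locally_convex.

HB.end.

Section locally_convex_notions.
Context (R : realType).
Implicit Types E F : tvsType R[i].

Definition generated_by E (I : Type) (p : I -> E -> R) : Prop :=
  forall U : set E, nbhs 0 U <->
    exists s e, 0 < e /\ all_lt p s e `<=` U.

Definition continuous_seminorm E (p : E -> R) : Prop :=
  is_seminorm p /\ continuous (p : E -> R^o).

(* [tvsType] does not force the uniform structure to be the one induced by the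
   additive group, hence Cauchy filters are defined from the neighbourhoods of
   0 instead of from the entourages. *)
Definition tvs_cauchy E (F : set_system E) : Prop :=
  forall U : set E, nbhs 0 U ->
    exists2 B, F B & forall x y, B x -> B y -> U (x - y).

Definition tvs_complete E : Prop :=
  forall F : set_system E, ProperFilter F -> tvs_cauchy F ->
    exists x : E, F --> x.

Definition is_frechet E : Prop :=
  [/\ hausdorff_space E, tvs_complete E &
      exists p : nat -> E -> R,
        (forall n, is_seminorm (p n)) /\ generated_by p].

Definition conj_linear E F (f : E -> F) : Prop :=
  forall (k : R[i]) x y, f (k *: x + y) = conjc k *: f x + f y.

Definition jointly_continuous E F (G : tvsType R[i]) (f : E -> F -> G) : Prop :=
  continuous (fun z : E * F => f z.1 z.2).

End locally_convex_notions.

Section projective_tensor.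
Context (R : realType).

Section definition.
Context (E F T : tvsType R[i]) (t : {bilinear E -> F -> T}).

Definition tensor_sum (s : seq (E * F)) : T := \sum_(xy <- s) t xy.1 xy.2.

Definition projective_seminorm (p : E -> R) (q : F -> R) (z : T) : R :=
  inf [set r | exists2 s, z = tensor_sum s &
                          r = \sum_(xy <- s) p xy.1 * q xy.2].

(* [T] is a completion of the algebraic tensor product of [E] and [F] equipped
   with the projective topology. By [cpt_algebraic], [range tensor_sum] is the
   algebraic tensor product: a finite sum of elementary tensors vanishes in [T]
   only if it is mapped to 0 by every bilinear map. The topology induced on it
   by [T] is defined by the seminorms [projective_seminorm p q]; as [p] and [q]
   can be scaled, their open unit balls form a base at 0. *)
Record is_completed_projective_tensor : Prop := {
  cpt_hausdorff : hausdorff_space T ;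
  cpt_complete : tvs_complete T ;
  cpt_algebraic : forall (V : lmodType R[i]) (b : {bilinear E -> F -> V})
      (s : seq (E * F)),
    tensor_sum s = 0 -> \sum_(xy <- s) b xy.1 xy.2 = 0 ;
  cpt_dense : dense (range tensor_sum) ;
  cpt_topology : forall U : set T,
    (exists2 V, nbhs 0 V & V `&` range tensor_sum `<=` U) <->
    (exists p q, [/\ continuous_seminorm p, continuous_seminorm q &
       [set z | projective_seminorm p q z < 1] `&` range tensor_sum `<=` U])
}.

End definition.

Record cptensor (E F : tvsType R[i]) := CPTensor {
  cpt_space :> tvsType R[i] ;
  tens : {bilinear E -> F -> cpt_space} ;
  tensP : is_completed_projective_tensor tens
}.

(* [h] is the continuous linear map on the completed projective tensor product
   that corresponds to the bilinear map [b]. *)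
Definition linearizes (E F X : tvsType R[i]) (T : cptensor E F)
    (b : E -> F -> X) (h : T -> X) : Prop :=
  [/\ linear h, continuous h & forall x y, h (tens T x y) = b x y].

End projective_tensor.

Record hopf_star_maps (R : realType) (A : tvsType R[i]) (AA : cptensor A A) :=
  HopfStarMaps {
    hmul : {bilinear A -> A -> A} ;
    hone : A ;
    hstar : A -> A ;
    hantipode : {linear A -> A} ;
    hcounit : {scalar A} ;
    hcomul : {linear A -> AA}
  }.

(* All maps named in the axioms on [AA] and on the triple tensor products are
   the unique continuous extensions of their values on elementary tensors. *)
Record frechet_hopf_star (R : realType) (A : tvsType R[i]) (AA : cptensor A A)
    (H : hopf_star_maps AA) : Prop := {
  fh_frechet : is_frechet A ;
  fh_mul_continuous : jointly_continuous (hmul H) ;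
  fh_star_continuous : continuous (hstar H) ;
  fh_antipode_continuous : continuous (hantipode H) ;
  fh_counit_continuous : continuous (hcounit H : A -> R[i]^o) ;
  fh_comul_continuous : continuous (hcomul H) ;
  fh_mulA : forall x y z, hmul H (hmul H x y) z = hmul H x (hmul H y z) ;
  fh_mul1 : forall x, hmul H (hone H) x = x /\ hmul H x (hone H) = x ;
  fh_comulA : exists (AA_A : cptensor AA A) (A_AA : cptensor A AA)
      (comul_id : AA -> AA_A) (id_comul : AA -> A_AA) (assoc : AA_A -> A_AA),
    [/\ linearizes (fun x y => tens AA_A (hcomul H x) y) comul_id,
        linearizes (fun x y => tens A_AA x (hcomul H y)) id_comul,
        linear assoc /\ continuous assoc,
        forall x y z, assoc (tens AA_A (tens AA x y) z) =
                      tens A_AA x (tens AA y z) &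
        forall a, assoc (comul_id (hcomul H a)) = id_comul (hcomul H a)] ;
  fh_comul_counit : exists counit_id id_counit : AA -> A,
    [/\ linearizes (fun x y => hcounit H x *: y) counit_id,
        linearizes (fun x y => hcounit H y *: x) id_counit &
        forall a, counit_id (hcomul H a) = a /\ id_counit (hcomul H a) = a] ;
  fh_comul_mul : exists mulAA : {bilinear AA -> AA -> AA},
    [/\ jointly_continuous mulAA,
        forall x y x' y', mulAA (tens AA x y) (tens AA x' y') =
                          tens AA (hmul H x x') (hmul H y y') &
        forall a b, hcomul H (hmul H a b) = mulAA (hcomul H a) (hcomul H b)] ;
  fh_comul_one : hcomul H (hone H) = tens AA (hone H) (hone H) ;
  fh_counit_mul : forall a b, hcounit H (hmul H a b) = hcounit H a * hcounit H b ;
  fh_counit_one : hcounit H (hone H) = 1 ;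
  fh_antipode : exists mulL antipode_id id_antipode,
    [/\ linearizes (T := AA) (hmul H) mulL,
        linearizes (fun x y => tens AA (hantipode H x) y) antipode_id,
        linearizes (fun x y => tens AA x (hantipode H y)) id_antipode,
        forall a, mulL (antipode_id (hcomul H a)) = hcounit H a *: hone H &
        forall a, mulL (id_antipode (hcomul H a)) = hcounit H a *: hone H] ;
  fh_star_conj_linear : conj_linear (hstar H) ;
  fh_starK : involutive (hstar H) ;
  fh_star_mul : forall a b,
    hstar H (hmul H a b) = hmul H (hstar H b) (hstar H a) ;
  fh_comul_star : exists starAA : AA -> AA,
    [/\ conj_linear starAA, continuous starAA,
        forall x y, starAA (tens AA x y) = tens AA (hstar H x) (hstar H y) &
        forall a, hcomul H (hstar H a) = starAA (hcomul H a)] ;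
  fh_counit_star : forall a, hcounit H (hstar H a) = conjc (hcounit H a) ;
  fh_antipode_star : forall a, hantipode H (hstar H (hantipode H (hstar H a))) = a
}.

(* The seminorms are only required to be submultiplicative, not to be
   normalized at the unit. *)
Definition locally_m_convex (R : realType) (A : tvsType R[i])
    (mul : A -> A -> A) : Prop :=
  exists (I : Type) (p : I -> A -> R),
    [/\ forall i, is_seminorm (p i),
        forall i a b, p i (mul a b) <= p i a * p i b & generated_by p].

Section word_length.
Context (G : groupType).

Definition is_word (S : seq G) (w : seq G) (g : G) : Prop :=
  {subset w <= S} /\ (\prod_(x <- w) x)%g = g.

Definition generates (S : seq G) : Prop := forall g, exists w, is_word S w g.

Definition finitely_generated : Prop :=
  exists S : seq G, generates (S ++ [seq (x^-1)%g | x <- S]).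

Definition is_word_length_for (S : seq G) (L : G -> nat) : Prop :=
  forall g, (exists2 w, is_word S w g & size w = L g) /\
            (forall w, is_word S w g -> (L g <= size w)%N).

Definition is_word_length (L : G -> nat) : Prop :=
  exists S : seq G, [/\ forall x, x \in S -> (x^-1)%g \in S,
                        generates S & is_word_length_for S L].

End word_length.

Section growth.
Context (R : realType) (sigma : nat -> R).

Definition growth_function : Prop :=
  [/\ forall n, 1 <= sigma n, forall n, sigma n <= sigma n.+1 &
      forall M, exists n, M < sigma n].

Definition submultiplicative : Prop :=
  forall n m, sigma (n + m)%N <= sigma n * sigma m.

Definition almost_submultiplicative : Prop :=
  forall e, 0 < e -> exists2 c, 0 < c & forall n m,
    sigma (n + m)%N <= c * sigma n `^ (1 + e) * sigma m `^ (1 + e).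

End growth.

Section rapidly_decreasing.
Context (R : realType) (G : groupType) (L : G -> nat) (sigma : nat -> R).
Implicit Types (a b : G -> R[i]^o) (r : R).

Definition wnorm r a : \bar R :=
  \esum_(g in [set: G]) (normc (a g) * sigma (L g) `^ r)%:E.

Definition ell1 r : set (G -> R[i]^o) := [set a | (wnorm r a < +oo)%E].

Definition rapid_set : set (G -> R[i]^o) :=
  \bigcap_(r in [set r | 0 <= r]) ell1 r.

Let wnorm_ge0 r a : (0 <= wnorm r a)%E.
Proof.
by apply: esum_ge0 => g _; rewrite lee_fin mulr_ge0 ?powR_ge0 ?normc_ge0.
Qed.

Lemma wnormD r a b : (wnorm r (a + b)%R <= wnorm r a + wnorm r b)%E.
Proof.
rewrite /wnorm -esumD; first last.
- by move=> g _; rewrite lee_fin mulr_ge0 ?powR_ge0 ?normc_ge0.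
- by move=> g _; rewrite lee_fin mulr_ge0 ?powR_ge0 ?normc_ge0.
apply: le_esum => g _; rewrite -EFinD lee_fin -mulrDl.
by rewrite ler_wpM2r ?powR_ge0// le_normcD.
Qed.

Lemma wnormZ_le r (k : R[i]) a : (wnorm r (k *: a) <= (normc k)%:E * wnorm r a)%E.
Proof.
have k0 := normc_ge0 k.
apply: ub_ereal_sup => _ [X [Xfin XG] <-].
rewrite (@le_trans _ _
  ((normc k)%:E * \sum_(g \in X) (normc (a g) * sigma (L g) `^ r)%:E))%E//.
  rewrite !fsbig_finite//= !sumEFin -EFinM lee_fin mulr_sumr.
  by apply: ler_sum => g _; rewrite /= normcM mulrA.
by rewrite lee_wpmul2l ?lee_fin//; apply: ereal_sup_ubound; exists X.
Qed.

Lemma wnormZ r (k : R[i]) a : wnorm r (k *: a) = ((normc k)%:E * wnorm r a)%E.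
Proof.
apply/eqP; rewrite eq_le wnormZ_le/=.
have [->|k0] := eqVneq k 0; first by rewrite normc0 mul0e.
have nk0 : 0 < normc k.
  rewrite lt_def normc_ge0 andbT; apply: contra_neq k0.
  exact: eq0_normc.
rewrite -lee_pdivlMl//; have := wnormZ_le r k^-1 (k *: a).
by rewrite scalerA mulVf// scale1r normcV.
Qed.

Lemma wnorm0 r : wnorm r 0 = 0%E.
Proof. by rewrite -[0](scale0r 0) wnormZ normc0 mul0e. Qed.

Definition rapid_pred : {pred G -> R[i]^o} := mem rapid_set.

Let rapid_submod_closed : submod_closed rapid_pred.
Proof.
split=> [|k a b]; rewrite !inE/=; first by move=> r _; rewrite /ell1/= wnorm0.
move=> aP bP r r0; rewrite /ell1/=; apply: le_lt_trans (wnormD _ _ _) _.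
rewrite wnormZ lte_add_pinfty//; last exact: bP.
by apply: lte_mul_pinfty; rewrite ?lee_fin ?normc_ge0//; exact: aP.
Qed.

HB.instance Definition _ := GRing.isSubmodClosed.Build R[i] (G -> R[i]^o)
  rapid_pred rapid_submod_closed.

Record rapid : Type := Rapid {
  coeff :> G -> R[i]^o ;
  coeffP : coeff \in rapid_pred
}.

HB.instance Definition _ := [isSub for coeff].
HB.instance Definition _ := [Choice of rapid by <:].
HB.instance Definition _ := [SubChoice_isSubLmodule of rapid by <:].

Definition rapid_norm (r : {nonneg R}) (a : rapid) : R := fine (wnorm r%:num a).

Lemma rapid_normE (r : {nonneg R}) (a : rapid) :
  (rapid_norm r a)%:E = wnorm r%:num a.
Proof.
rewrite fineK// ge0_fin_numE//.
by have := coeffP a; rewrite inE; apply => /=.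
Qed.

Let rapid_norm_seminorm (r : {nonneg R}) : is_seminorm (rapid_norm r).
Proof.
split=> [a b|k a]; rewrite -?lee_fin ?EFinD ?rapid_normE; first exact: wnormD.
by apply: EFin_inj; rewrite EFinM !rapid_normE wnormZ.
Qed.

HB.instance Definition _ := Seminorms_isTvs.Build R rapid rapid_norm_seminorm.

Lemma nbhs_rapid (a : rapid) (U : set rapid) : nbhs a U <->
  exists s e, 0 < e /\ forall b : rapid, all_lt rapid_norm s e (b - a) -> U b.
Proof. by []. Qed.

Lemma finite_support_rapid (a : G -> R[i]^o) :
  finite_set [set g | a g != 0] -> rapid_set a.
Proof.
move=> afin r _; rewrite /ell1/= /wnorm.
rewrite (_ : [set: G] = [set g | a g != 0] `|` [set g | a g = 0]); last first.
  by apply/seteqP; split => // g _ /=; case: eqVneq; [right|left].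
rewrite (_ : esum _ _ = \esum_(g in [set g | a g != 0])
    (normc (a g) * sigma (L g) `^ r)%:E); last first.
  rewrite [RHS]esum_mkcond [LHS]esum_mkcond; apply: eq_esum => g _.
  rewrite mem_set; last by rewrite /=; case: (eqVneq (a g)); [right|left].
  case: ifPn => //; rewrite notin_setE/= => /negP; rewrite negbK => /eqP ->.
  by rewrite normc0 mul0r.
rewrite esum_fset//; last first.
  by move=> g _; rewrite lee_fin mulr_ge0 ?powR_ge0 ?normc_ge0.
by rewrite fsbig_finite//= sumEFin ltry.
Qed.

Definition delta_fun (g h : G) : R[i]^o := (h == g)%:R.

Lemma delta_fun_rapid g : delta_fun g \in rapid_pred.
Proof.
apply/mem_set/finite_support_rapid; apply: (sub_finite_set _ (finite_set1 g)).
by move=> h /=; rewrite /delta_fun; case: (eqVneq h g) => //=; rewrite eqxx.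
Qed.

Definition delta g : rapid := Rapid (delta_fun_rapid g).

Definition group_algebra : set rapid := [set a | finite_set [set g | a g != 0]].

End rapidly_decreasing.

(* The structure maps of the group algebra, with basis [delta g]; the product
   and the unit are determined by their values on the basis. *)
Record extends_group_algebra (R : realType) (G : groupType) (L : G -> nat)
    (sigma : nat -> R) (AA : cptensor (rapid L sigma) (rapid L sigma))
    (H : hopf_star_maps AA) : Prop := {
  ega_mul : forall g h,
    hmul H (delta L sigma g) (delta L sigma h) = delta L sigma (g * h)%g ;
  ega_one : hone H = delta L sigma 1%g ;
  ega_star : forall a, group_algebra a ->
    forall g, hstar H a g = conjc (a (g^-1)%g) ;
  ega_antipode : forall a, group_algebra a ->
    forall g, hantipode H a g = a (g^-1)%g ;
  ega_counit : forall a, group_algebra a ->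
    hcounit H a = \sum_(g \in [set: G]) a g ;
  ega_comul : forall a, group_algebra a ->
    hcomul H a =
    \sum_(g \in [set: G]) a g *: tens AA (delta L sigma g) (delta L sigma g)
}.

(* Main.v *)
(** As sequence spaces, A_sigma(G) (x)_pi A_sigma(H) is again of the form
    A_w(G * H), with weight w(g, h) = sigma(L g) * sigma(L h): the projective
    tensor product of weighted l^1 spaces is the weighted l^1 space of the
    product.  A bounded linear map out of such a space is determined by its
    values on the basis [delta g], and every polynomially bounded choice of
    values extends, by completeness.  In particular a map [f] of groups along
    which the weights grow at most polynomially induces a push-forward
    [delta g |-> delta (f g)].  Product, antipode, counit and coproduct are
    push-forwards (the product by almost submultiplicativity of sigma), so that
    each Hopf algebra axiom only has to be checked on the basis, where it is a
    group identity.  Independence of L is the push-forward along the identity,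
    as word lengths are Lipschitz equivalent and sigma(k n) is bounded by a
    power of sigma(n). *)

Require Import Defs.
From HB Require Import structures.
From mathcomp Require Import all_boot all_order all_algebra.
From mathcomp Require Import sesquilinear complex.
From mathcomp Require Import all_classical all_reals all_analysis.
From mathcomp Require Import interval_inference.
From mathcomp Require Import ring lra.

Set Implicit Arguments.
Unset Strict Implicit.
Unset Printing Implicit Defensive.

Import Order.TTheory GRing.Theory Num.Theory.
Import numFieldNormedType.Exports.
Import ComplexField.Normc.

Local Open Scope classical_set_scope.
Local Open Scope ring_scope.

(** * Rapidly decreasing functions *)

(** The spaces are set up for an arbitrary length and an arbitrary weight with values at least 1.
    The tensor product of two of them is then again of type [rapid], and one theory of bounded maps
    serves [A], [AA] and the threefold and fourfold products. In the Hopf part, word lengths enter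
    only through the tameness of multiplication and inversion. Two structure maps do not fit
    directly. The counit is scalar valued; what is pushed forward is the counit followed by the
    unit, along the constant map, so that its axioms also become identities between maps into [A].
    The involution is conjugate linear; it is the antipode followed by coefficientwise conjugation,
    which commutes with every push-forward. The analytic obstacle is the projective topology. Its
    seminorms are infima over finite representations, whereas the expansion of an element in the
    basis is infinite. A finite tensor sum is therefore split into a finitely supported part, whose
    basis expansion is optimal, and a remainder that is still a finite tensor sum and can be made
    arbitrarily cheap. *)

Lemma ler_sum_uniq (R : numDomainType) (I : eqType) (F : I -> R) (s t : seq I) :
  (forall i, 0 <= F i) -> uniq s -> uniq t -> {subset s <= t} ->
  \sum_(i <- s) F i <= \sum_(i <- t) F i.
Proof.
move=> F0 us ut st; rewrite [leRHS](bigID (mem s))/= -[leLHS]addr0 lerD//.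
  rewrite -[leRHS]big_filter (perm_big [seq i <- t | i \in s])//.
  apply: uniq_perm => //; first by rewrite filter_uniq.
  move=> i; rewrite mem_filter; case: (boolP (i \in s)) => //= si.
  by rewrite st.
exact: sumr_ge0.
Qed.

Lemma normc_conj (R : rcfType) (z : R[i]) : normc (conjc z) = normc z.
Proof. by case: z => x y /=; rewrite sqrrN. Qed.

Section rapid_basic.
Context (R : realType) (G : groupType) (L : G -> nat) (sigma : nat -> R).
Local Notation A := (rapid L sigma).
Local Notation N := (@rapid_norm R G L sigma).
Implicit Types (a b : A) (r : {nonneg R}) (s t : seq G).

Lemma rapidP a b : (forall g, a g = b g) -> a = b.
Proof. by move=> ab; apply: val_inj; apply/funext. Qed.

Lemma coeffD a b g : (a + b) g = a g + b g. Proof. by []. Qed.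
Lemma coeffN a g : (- a) g = - a g. Proof. by []. Qed.
Lemma coeffB a b g : (a - b) g = a g - b g. Proof. by []. Qed.
Lemma coeffZ k a g : (k *: a) g = k * a g. Proof. by []. Qed.

Lemma coeff_sum I (s : seq I) (F : I -> A) g :
  (\sum_(i <- s) F i) g = \sum_(i <- s) F i g.
Proof. by elim: s => [|i s ih]; rewrite ?big_nil// !big_cons coeffD ih. Qed.

Lemma coeff_delta g h : delta L sigma g h = (h == g)%:R. Proof. by []. Qed.

Lemma rapid_norm_seminorm r : is_seminorm (N r).
Proof.
split=> [a b|k a]; first by rewrite -lee_fin EFinD !rapid_normE; exact: wnormD.
by apply: EFin_inj; rewrite EFinM !rapid_normE wnormZ.
Qed.

Lemma wnorm_le (a : G -> R[i]^o) (r : R) M :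
  (forall s, uniq s -> \sum_(g <- s) normc (a g) * sigma (L g) `^ r <= M) ->
  (wnorm L sigma r a <= M%:E)%E.
Proof.
move=> aM; apply: ge_ereal_sup => _ [X [Xfin _] <-].
by rewrite fsbig_finite//= sumEFin lee_fin; apply: aM; exact: finmap.fset_uniq.
Qed.

Lemma wnorm_sum_le (a : G -> R[i]^o) (r : R) s : uniq s ->
  ((\sum_(g <- s) normc (a g) * sigma (L g) `^ r)%:E <= wnorm L sigma r a)%E.
Proof.
move=> us; apply: ereal_sup_ubound; exists [set` s].
  by split=> //; exact: finite_seq.
by rewrite -fsbig_seq// sumEFin.
Qed.

Lemma rapid_norm_le r a M :
  (forall s, uniq s -> \sum_(g <- s) normc (a g) * sigma (L g) `^ r%:num <= M) ->
  N r a <= M.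
Proof. by move=> aM; rewrite -lee_fin rapid_normE; exact: wnorm_le. Qed.

Lemma rapid_norm_sum r a s : uniq s ->
  \sum_(g <- s) normc (a g) * sigma (L g) `^ r%:num <= N r a.
Proof. by move=> us; rewrite -lee_fin rapid_normE; exact: wnorm_sum_le. Qed.

Lemma rapid_norm_ge0 r a : 0 <= N r a.
Proof. exact: seminorm_ge0 (rapid_norm_seminorm r) _. Qed.

Lemma rapid_norm0 r : N r 0 = 0.
Proof. exact: seminorm0 (rapid_norm_seminorm r). Qed.

Lemma rapid_normD r a b : N r (a + b) <= N r a + N r b.
Proof. exact: (rapid_norm_seminorm r).1. Qed.

Lemma rapid_normZ r k a : N r (k *: a) = normc k * N r a.
Proof. exact: (rapid_norm_seminorm r).2. Qed.

Lemma rapid_norm_delta r g : N r (delta L sigma g) <= sigma (L g) `^ r%:num.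
Proof.
apply: rapid_norm_le => s us; have [gs|gs] := boolP (g \in s).
  rewrite (bigD1_seq g)//= big1 ?addr0 => [|h /negbTE hg].
    by rewrite /= /delta_fun eqxx normc1 mul1r.
  by rewrite /= /delta_fun hg normc0 mul0r.
rewrite big_seq big1 ?powR_ge0// => h hs; rewrite coeff_delta.
by case: eqVneq => [hg|]; [rewrite -hg hs in gs|rewrite normc0 mul0r].
Qed.

Definition trunc s a : A := \sum_(g <- s) a g *: delta L sigma g.

Lemma coeff_trunc s a g : uniq s ->
  trunc s a g = if g \in s then a g else 0.
Proof.
move=> us; rewrite coeff_sum; case: ifPn => gs.
  rewrite (bigD1_seq g)//= big1 ?addr0 => [|h /negbTE hg].
    by rewrite -[LHS]/(a g * (g == g)%:R) eqxx mulr1.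
  by rewrite -[LHS]/(a h * (g == h)%:R) eq_sym hg mulr0.
rewrite big_seq big1// => h hs; rewrite coeffZ coeff_delta.
by case: eqVneq => [gh|]; [rewrite gh hs in gs|rewrite mulr0].
Qed.

Lemma rapid_norm_trunc r s a : uniq s -> N r (trunc s a) <= N r a.
Proof.
move=> us; apply: rapid_norm_le => t ut; apply: le_trans (rapid_norm_sum r a ut).
apply: ler_sum => g _; rewrite coeff_trunc//; case: ifP => // _.
by rewrite normc0 mul0r mulr_ge0 ?powR_ge0 ?normc_ge0.
Qed.

(** Take [s] whose partial sum misses the norm by less than [e / 2]. A larger [t] captures at least
    as much, so the part outside [t] weighs at most [e / 2]. *)
Lemma rapid_norm_tail r a e : 0 < e -> exists2 s, uniq s &
  forall t, uniq t -> {subset s <= t} -> N r (a - trunc t a) < e.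
Proof.
move=> e0; have e20 : 0 < e / 2 by rewrite divr_gt0.
have [s us sa] : exists2 s, uniq s & N r a - e / 2 <
    \sum_(g <- s) normc (a g) * sigma (L g) `^ r%:num.
  apply: contrapT => /forall2NP H; suff : N r a <= N r a - e / 2.
    by move=> ?; lra.
  apply: rapid_norm_le => s us; rewrite leNgt; apply/negP.
  by case: (H s).
exists s => // t ut st; apply: (@le_lt_trans _ _ (e / 2)); last first.
  by rewrite ltr_pdivrMr// mulr2n mulrDr mulr1 ltrDr.
apply: rapid_norm_le => u uu.
(* Over an index set that contains [t], the sum of the tail is the difference of two partial sums of
   [a]. *)
pose v := undup (t ++ u); have uv : uniq v by exact: undup_uniq.
pose F g := normc (a g) * sigma (L g) `^ r%:num.
have F0 g : 0 <= F g by rewrite mulr_ge0 ?powR_ge0 ?normc_ge0.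
have FE g : normc ((a - trunc t a) g) * sigma (L g) `^ r%:num =
    if g \in t then 0 else F g.
  rewrite coeffB coeff_trunc//; case: ifP; rewrite ?subr0// subrr.
  by rewrite normc0 mul0r.
under eq_bigr do rewrite FE.
have uv' : {subset u <= v} by move=> g; rewrite mem_undup mem_cat orbC => ->.
have tv' : {subset t <= v} by move=> g; rewrite mem_undup mem_cat => ->.
apply: (@le_trans _ _ (\sum_(g <- v) if g \in t then 0 else F g)).
  by apply: ler_sum_uniq => // g; case: ifP.
have -> : \sum_(g <- v) (if g \in t then 0 else F g) =
    \sum_(g <- v) F g - \sum_(g <- t) F g.
  apply/eqP; rewrite eq_sym subr_eq (bigID (mem t))/= addrC; apply/eqP.
  congr (_ + _).
    by rewrite big_mkcond; apply: eq_bigr => g _; case: (g \in t).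
  rewrite -big_filter; apply: perm_big; apply: uniq_perm => //.
    by rewrite filter_uniq.
  move=> g; rewrite mem_filter; case: (boolP (g \in t)) => //= gt.
  by rewrite tv'.
have := rapid_norm_sum r a uv; rewrite -/F.
have : \sum_(g <- s) F g <= \sum_(g <- t) F g.
  exact: ler_sum_uniq.
lra.
Qed.
End rapid_basic.

Arguments rapid_norm_seminorm {R G L sigma} r.

(** * Completeness *)

Section complex_limits.
Context (R : realType).

Lemma normc_ge_Re (z : R[i]) : `|complex.Re z| <= normc z.
Proof.
by case: z => x y /=; rewrite -sqrtr_sqr ler_sqrt ?lerDl ?sqr_ge0// addr_ge0 ?sqr_ge0.
Qed.

Lemma normc_ge_Im (z : R[i]) : `|complex.Im z| <= normc z.
Proof.
by case: z => x y /=; rewrite -sqrtr_sqr ler_sqrt ?lerDr ?sqr_ge0// addr_ge0 ?sqr_ge0.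
Qed.

Lemma normc_le_ReIm (z : R[i]) : normc z <= `|complex.Re z| + `|complex.Im z|.
Proof.
case: z => x y /=; rewrite -[leRHS]ger0_norm ?addr_ge0// -sqrtr_sqr.
rewrite ler_sqrt ?sqr_ge0// sqrrD !real_normK ?num_real// lerD2r lerDl.
by rewrite mulrn_wge0// mulr_ge0.
Qed.

Variables (T : Type) (F : set_system T) (FF : ProperFilter F).
Implicit Types e : R.

Lemma real_cauchy_limit (f : T -> R) :
  (forall e, 0 < e -> exists2 B, F B &
    forall x y, B x -> B y -> `|f x - f y| < e) ->
  exists l, forall e, 0 < e -> exists2 B, F B & forall x, B x -> `|f x - l| < e.
Proof.
move=> fC; have fcvg : cvg (f @ F).
  apply: R_complete; apply: cauchy_exP => e e0.
  have [B FB BC] := fC _ e0; have [x Bx] := filter_ex FB.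
  exists (f x); rewrite -[_ _]/(F (f @^-1` ball (f x) e)).
  by apply: (filterS _ FB) => y By /=; rewrite -ball_normE; exact: BC.
exists (lim (f @ F)) => e e0.
exists [set x | `|f x - lim (f @ F)| < e] => //.
by have /cvgrPdistC_lt/(_ e e0) := fcvg.
Qed.

Lemma complex_cauchy_limit (f : T -> R[i]) :
  (forall e, 0 < e -> exists2 B, F B &
    forall x y, B x -> B y -> normc (f x - f y) < e) ->
  exists l, forall e, 0 < e -> exists2 B, F B &
    forall x, B x -> normc (f x - l) < e.
Proof.
move=> fC.
have [u uP] : exists l, forall e, 0 < e -> exists2 B, F B &
    forall x, B x -> `|complex.Re (f x) - l| < e.
  apply: real_cauchy_limit => e /fC[B FB BC]; exists B => // x y Bx By.
  apply: le_lt_trans _ (BC x y Bx By).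
  by rewrite -(raddfB (@complex.Re R)) normc_ge_Re.
have [v vP] : exists l, forall e, 0 < e -> exists2 B, F B &
    forall x, B x -> `|complex.Im (f x) - l| < e.
  apply: real_cauchy_limit => e /fC[B FB BC]; exists B => // x y Bx By.
  apply: le_lt_trans _ (BC x y Bx By).
  by rewrite -(raddfB (@complex.Im R)) normc_ge_Im.
exists (u +i* v)%C => e e0; have e20 : 0 < e / 2 by rewrite divr_gt0.
have [B FB BP] := uP _ e20; have [B' FB' BP'] := vP _ e20.
exists (B `&` B'); first exact: filterI.
move=> x [Bx Bx']; apply: le_lt_trans (normc_le_ReIm _) _.
rewrite (splitr e); move: (BP x Bx) (BP' x Bx').
by case: (f x) => p q /= ? ?; rewrite ltrD.
Qed.

End complex_limits.

(** * Neighbourhoods, separation, density and completeness of the weighted spaces *)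

Section rapid_topology.
Context (R : realType) (G : groupType) (L : G -> nat) (sigma : nat -> R).
Hypothesis sigma1 : forall n, 1 <= sigma n.
Local Notation A := (rapid L sigma).
Local Notation N := (@rapid_norm R G L sigma).
Implicit Types (a b : A) (r : {nonneg R}) (s t : seq G) (e : R).

Lemma weight_gt0 g r : 0 < sigma (L g) `^ r%:num.
Proof. by rewrite powR_gt0// (lt_le_trans ltr01). Qed.

Lemma rapid_norm_mono r1 r2 a : r1%:num <= r2%:num -> N r1 a <= N r2 a.
Proof.
move=> r12; apply: rapid_norm_le => s us; apply: le_trans (rapid_norm_sum r2 a us).
by apply: ler_sum => g _; rewrite ler_wpM2l ?normc_ge0// ler_powR.
Qed.

Lemma normc_coeff_le r a g : normc (a g) <= N r a.
Proof.
apply: le_trans (rapid_norm_sum r a (s := [:: g]) _) => //.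
rewrite big_seq1 ler_peMr ?normc_ge0//.
by rewrite -[leLHS](powRr0 (sigma (L g))) ler_powR.
Qed.

(** Weights are at least 1, so the norms increase with the exponent and the largest exponent
    dominates. Every neighbourhood can thus be described by a single norm. *)
Lemma rapid_norm_directed (rs : seq {nonneg R}) :
  exists r, forall r', r' \in rs -> forall a, N r' a <= N r a.
Proof.
elim: rs => [|r0 rs [r ih]]; first by exists 0%:nng.
have m0 : 0 <= Num.max r0%:num r%:num by rewrite le_max ge0.
exists (NngNum m0) => r'; rewrite inE => /predU1P[->|/ih r'r] a.
  by apply: rapid_norm_mono; rewrite /= le_max lexx.
by apply: le_trans (r'r a) _; apply: rapid_norm_mono; rewrite /= le_max lexx orbT.
Qed.

Lemma rapid_nbhsP a (U : set A) : nbhs a U <->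
  exists r e, 0 < e /\ forall b, N r (b - a) < e -> U b.
Proof.
split=> [/nbhs_rapid[rs [e [e0 sU]]]|[r [e [e0 rU]]]].
  have [r rP] := rapid_norm_directed rs.
  exists r, e; split=> // b bae; apply: sU; apply/allP => r' /rP r'r.
  exact: le_lt_trans (r'r _) bae.
apply/nbhs_rapid; exists [:: r], e; split=> // b.
by rewrite /all_lt/= andbT => /rU.
Qed.

Lemma rapid_norm_eq0 a : (forall e, 0 < e -> N 0%:nng a < e) -> a = 0.
Proof.
move=> a0; apply: rapidP => g; apply: eq0_normc; apply/eqP.
rewrite eq_le normc_ge0 andbT leNgt; apply/negP => /a0.
by rewrite ltNge normc_coeff_le.
Qed.

Lemma rapid_hausdorff : hausdorff_space A.
Proof.
move=> a b ab; apply/eqP; rewrite -subr_eq0; apply/eqP/rapid_norm_eq0 => e e0.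
have e20 : 0 < e / 2 by rewrite divr_gt0.
have nb c : nbhs c [set d | N 0%:nng (d - c) < e / 2].
  by apply/rapid_nbhsP; exists 0%:nng, (e / 2); split.
have [c [/= ca cb]] := ab _ _ (nb a) (nb b).
rewrite -(subrK c a) -addrA (splitr e).
apply: le_lt_trans (rapid_normD _ _ _) _; rewrite ltrD//.
by rewrite (seminormB (rapid_norm_seminorm _)).
Qed.

Lemma trunc_group_algebra s a : uniq s -> group_algebra (trunc s a).
Proof.
move=> us; apply: (sub_finite_set _ (finite_seq s)) => g /=.
by rewrite coeff_trunc//; case: ifP; rewrite ?eqxx.
Qed.

Lemma group_algebra_dense : dense (@group_algebra R G L sigma).
Proof.
move=> O [a Oa] oO; have /rapid_nbhsP[r [e [e0 eO]]] : nbhs a O.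
  by apply: open_nbhs_nbhs; split.
have [s us sP] := rapid_norm_tail r a e0.
exists (trunc s a); split; last exact: trunc_group_algebra.
by apply: eO; rewrite (seminormB (rapid_norm_seminorm _)); exact: sP.
Qed.

(** The limit is taken coefficientwise. The Cauchy estimate is a bound on finite partial sums, each
    of which involves finitely many coefficients, so it passes to the limit. The resulting bound
    gives both the summability of [x] and the convergence to it. *)
Lemma rapid_complete : tvs_complete A.
Proof.
move=> F FF FC.
have FCr r e : 0 < e ->
    exists2 B, F B & forall a b, B a -> B b -> N r (a - b) < e.
  move=> e0; apply: (FC [set a | N r a < e]).
  by apply/rapid_nbhsP; exists r, e; split=> // b; rewrite subr0.
have /choice[x xP] : forall g, exists l : R[i], forall e, 0 < e ->
    exists2 B, F B & forall a, B a -> normc (a g - l) < e.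
  move=> g; apply: complex_cauchy_limit => e /(FCr 0%:nng)[B FB BP].
  exists B => // a b Ba Bb.
  exact: le_lt_trans (normc_coeff_le _ (a - b) g) (BP _ _ Ba Bb).
have xS r s e : 0 < e -> exists2 B, F B & forall a, B a ->
    \sum_(g <- s) normc (a g - x g) * sigma (L g) `^ r%:num <= e.
  elim: s e => [|g s ih] e e0.
    by exists setT => [|a _]; [exact: filterT|rewrite big_nil ltW].
  have e20 : 0 < e / 2 by rewrite divr_gt0.
  have [B FB BP] := ih _ e20.
  have [|C FC' CP] := xP g (e / 2 / sigma (L g) `^ r%:num).
    by rewrite divr_gt0// weight_gt0.
  exists (B `&` C); first exact: filterI.
  move=> a [Ba Ca]; rewrite big_cons (splitr e) lerD//; last exact: BP.
  by rewrite -ler_pdivlMr ?weight_gt0// ltW// CP.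
(* Some [b] in [B] is within [d] of [x] on the finite set [s], and it is within [e] of [a] in
   norm. *)
have xB r e B a : B a -> F B -> (forall a b, B a -> B b -> N r (a - b) < e) ->
    forall s, uniq s ->
    \sum_(g <- s) normc (a g - x g) * sigma (L g) `^ r%:num <= e.
  move=> Ba FB BP s us; apply/ler_addgt0Pr => d d0.
  have [C FC' CP] := xS r s _ d0.
  have [b [Bb Cb]] := filter_ex (filterI FB FC').
  apply: (@le_trans _ _
      (N r (a - b) + \sum_(g <- s) normc (b g - x g) * sigma (L g) `^ r%:num)).
    apply: le_trans (lerD (rapid_norm_sum r (a - b) us) (lexx _)).
    rewrite -big_split/=; apply: ler_sum => g _; rewrite -mulrDl ler_wpM2r ?powR_ge0//.
    have := le_normcD (a g - b g) (b g - x g).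
    by rewrite addrA subrK.
  by rewrite lerD// ?CP// ltW// BP.
have xA : x \in rapid_pred L sigma.
  rewrite inE => r r0; rewrite /ell1/=.
  have [B FB BP] := FCr (NngNum r0) _ ltr01; have [a Ba] := filter_ex FB.
  rewrite (_ : x = (x - a) + a :> (G -> R[i]^o)); last by rewrite subrK.
  apply: le_lt_trans (wnormD _ _ _ _ _) _; apply: lte_add_pinfty.
    apply: (@le_lt_trans _ _ 1%:E); last exact: ltry.
    apply: wnorm_le => s us; apply: le_trans (xB (NngNum r0) _ _ _ Ba FB BP s us).
    by apply: ler_sum => g _; rewrite -normcN opprB.
  by have := coeffP a; rewrite inE; apply.
exists (Rapid xA) => U /rapid_nbhsP[r [e [e0 eU]]].
have e20 : 0 < e / 2 by rewrite divr_gt0.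
have [B FB BP] := FCr r _ e20; apply: (filterS _ FB) => a Ba; apply: eU.
apply: (@le_lt_trans _ _ (e / 2)); last by rewrite ltr_pdivrMr// ltr_pMr// ltr1n.
by apply: rapid_norm_le => s us; exact: xB BP s us.
Qed.

(** Natural exponents are cofinal among all exponents, which yields a countable family of norms. *)
Lemma rapid_frechet : is_frechet A.
Proof.
split; [exact: rapid_hausdorff|exact: rapid_complete|].
exists (fun n : nat => N n%:R%:nng); split=> [n|U].
  exact: rapid_norm_seminorm.
split=> [/rapid_nbhsP[r [e [e0 eU]]]|[s [e [e0 sU]]]].
  exists [:: Num.bound r%:num], e; split=> // a; rewrite /all_lt/= andbT => ae.
  apply: eU; rewrite subr0; apply: le_lt_trans _ ae; apply: rapid_norm_mono.
  by rewrite /= ltW// archi_boundP.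
apply/nbhs_rapid; exists [seq n%:R%:nng | n <- s], e; split=> // b.
by rewrite subr0 /all_lt/= all_map => /sU.
Qed.

End rapid_topology.

(** * Bounded linear maps *)

Section bounded_maps.
Context (R : realType).

Definition bounded_linear (G H : groupType) (L : G -> nat) (M : H -> nat)
    (sigma tau : nat -> R) (f : rapid L sigma -> rapid M tau) : Prop :=
  linear f /\ forall r, exists (s : {nonneg R}) (C : R), 0 <= C /\
    forall a, rapid_norm r (f a) <= C * rapid_norm s a.

Definition bounded_bilinear (G H K : groupType) (L : G -> nat) (M : H -> nat)
    (P : K -> nat) (sigma tau ups : nat -> R)
    (f : rapid L sigma -> rapid M tau -> rapid P ups) : Prop :=
  [/\ forall b, linear (f^~ b), forall a, linear (f a) &
    forall r, exists (s t : {nonneg R}) (C : R), 0 <= C /\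
    forall a b, rapid_norm r (f a b) <= C * rapid_norm s a * rapid_norm t b].

Lemma linear_trunc (G : groupType) (L : G -> nat) (sigma : nat -> R)
    (V : lmodType R[i]) (f : rapid L sigma -> V) (s : seq G) a : linear f ->
  f (trunc s a) = \sum_(g <- s) a g *: f (delta L sigma g).
Proof.
move=> lf; rewrite /trunc; elim: s => [|g s ih].
  rewrite !big_nil; have := zmod_morphism_linear lf 0 0.
  by rewrite !subr0 subrr.
by rewrite !big_cons lf ih.
Qed.

Section one_map.
Variables (G H : groupType) (L : G -> nat) (M : H -> nat) (sigma tau : nat -> R).
Hypotheses (sigma1 : forall n, 1 <= sigma n) (tau1 : forall n, 1 <= tau n).
Local Notation A := (rapid L sigma).
Local Notation B := (rapid M tau).
Implicit Types (a : A) (b : B) (r s : {nonneg R}) (t v : seq G) (e C : R).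

Lemma bounded_linear_continuous (f : A -> B) : bounded_linear f -> continuous f.
Proof.
move=> [lf bf] a U /(rapid_nbhsP tau1)[r [e [e0 eU]]].
have [s [C [C0 fC]]] := bf r.
apply/(rapid_nbhsP sigma1); exists s, (e / (C + 1)).
have C10 : 0 < C + 1 by rewrite ltr_wpDl.
split=> [|b ba]; first by rewrite divr_gt0.
apply: eU; rewrite -(zmod_morphism_linear lf); apply: le_lt_trans (fC _) _.
rewrite ltr_pdivlMr// in ba; apply: le_lt_trans _ ba.
by rewrite mulrC ler_wpM2l ?rapid_norm_ge0// lerDl.
Qed.

(** The bound of unknown size coming from [bf] is spent only on the tail left by a truncation, which
    is arbitrarily small. On the truncation the triangle inequality applies with [C]. The constant
    on the basis thus carries over without loss, which is what makes the norms exactly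
    submultiplicative later. *)
Lemma bounded_linear_bound (f : A -> B) r s C : bounded_linear f -> 0 <= C ->
  (forall g, rapid_norm r (f (delta L sigma g)) <= C * sigma (L g) `^ s%:num) ->
  forall a, rapid_norm r (f a) <= C * rapid_norm s a.
Proof.
move=> [lf bf] C0 fC a; apply/ler_addgt0Pr => e e0.
have [s' [C' [C'0 fC']]] := bf r.
have C10 : 0 < C' + 1 by rewrite ltr_wpDl.
have [|t ut tP] := rapid_norm_tail s' a (e := e / (C' + 1)).
  by rewrite divr_gt0.
rewrite -{1}(subrK (trunc t a) a) -[a - _]scale1r lf scale1r addrC.
apply: le_trans (rapid_normD _ _ _) _; apply: lerD.
  rewrite linear_trunc//; apply: (@le_trans _ _
      (\sum_(g <- t) C * (normc (a g) * sigma (L g) `^ s%:num))).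
    elim: t {ut tP} => [|g t ih]; first by rewrite !big_nil rapid_norm0.
    rewrite !big_cons; apply: le_trans (rapid_normD _ _ _) _; apply: lerD ih.
    by rewrite rapid_normZ mulrCA ler_wpM2l ?normc_ge0.
  by rewrite -mulr_sumr ler_wpM2l// rapid_norm_sum.
apply: le_trans (fC' _) _; have := tP t ut (fun _ => id).
rewrite ltr_pdivlMr// => /ltW; apply: le_trans.
by rewrite mulrC ler_wpM2l ?rapid_norm_ge0// lerDl.
Qed.

(** The difference vanishes on the basis, so the preceding bound holds for it with constant 0. *)
Lemma bounded_linear_ext (f f' : A -> B) :
  bounded_linear f -> bounded_linear f' ->
  (forall g, f (delta L sigma g) = f' (delta L sigma g)) -> f =1 f'.
Proof.
move=> [lf bf] [lf' bf'] ff' a; apply/eqP; rewrite -subr_eq0; apply/eqP.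
pose h a := f a - f' a.
have bh : bounded_linear h.
  split=> [k x y|r].
    by rewrite /h lf lf' scalerBr opprD addrACA.
  have [s [C [C0 fC]]] := bf r; have [s' [C' [C'0 fC']]] := bf' r.
  have [q qP] := rapid_norm_directed L sigma1 [:: s; s'].
  exists q, (C + C'); split=> [|x]; first exact: addr_ge0.
  apply: le_trans (rapid_normD _ _ _) _.
  rewrite (seminormN (rapid_norm_seminorm r)) mulrDl lerD//.
    by apply: le_trans (fC _) _; rewrite ler_wpM2l// qP// inE eqxx.
  by apply: le_trans (fC' _) _; rewrite ler_wpM2l// qP// !inE eqxx orbT.
apply: (rapid_norm_eq0 tau1) => e e0; apply: le_lt_trans _ e0.
rewrite -[leRHS](mul0r (rapid_norm 0%:nng a)) -/(h a).
apply: bounded_linear_bound => // g.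
by rewrite /h ff' subrr rapid_norm0 mul0r.
Qed.

Section extension.
Variable u : G -> B.
Hypothesis uB : forall r, exists s C, 0 <= C /\
  forall g, rapid_norm r (u g) <= C * sigma (L g) `^ s%:num.

Let psum t a : B := \sum_(g <- t) a g *: u g.

(** Unconditional summation: convergence, in every norm, along the finite index sets ordered by
    inclusion. Linearity of the extension then follows from uniqueness of sums. *)
Let has_sum a b := forall r e, 0 < e -> exists2 t, uniq t &
  forall v, uniq v -> {subset t <= v} -> rapid_norm r (b - psum v a) < e.

Let psum_bound r s C t a : 0 <= C -> uniq t ->
  (forall g, rapid_norm r (u g) <= C * sigma (L g) `^ s%:num) ->
  rapid_norm r (psum t a) <= C * rapid_norm s a.
Proof.
move=> C0 ut uC; apply: (@le_trans _ _
    (\sum_(g <- t) C * (normc (a g) * sigma (L g) `^ s%:num))); last first.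
  by rewrite -mulr_sumr ler_wpM2l// rapid_norm_sum.
rewrite /psum; elim: t {ut} => [|g t ih]; first by rewrite !big_nil rapid_norm0.
rewrite !big_cons; apply: le_trans (rapid_normD _ _ _) _; apply: lerD ih.
by rewrite rapid_normZ mulrCA ler_wpM2l ?normc_ge0.
Qed.

(** Two partial sums over different index sets become sums over a common one, so that their
    difference is a partial sum of a single element and [psum_bound] applies. *)
Let psum_trunc t v a : uniq t -> uniq v -> {subset t <= v} ->
  psum v (trunc t a) = psum t a.
Proof.
move=> ut uv tv; rewrite /psum (bigID (mem t))/= addrC big1 ?add0r => [|g gt].
  rewrite -big_filter (perm_big t)/=.
    by apply: eq_big_seq => g gt; rewrite coeff_trunc// gt.
  apply: uniq_perm => //; first by rewrite filter_uniq.
  by move=> g; rewrite mem_filter; case: (boolP (g \in t)) => //= /tv.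
by rewrite coeff_trunc// (negbTE gt) scale0r.
Qed.

Let psum_linear t k a a' : psum t (k *: a + a') = k *: psum t a + psum t a'.
Proof.
rewrite /psum scaler_sumr -big_split/=; apply: eq_bigr => g _.
by rewrite scalerA -scalerDl.
Qed.

Let has_sum_ex a : exists b, has_sum a b.
Proof.
(* The filter of tails of the net of partial sums; completeness provides its limit. *)
pose F : set_system B := [set U | exists2 t, uniq t &
  forall v, uniq v -> {subset t <= v} -> U (psum v a)].
have FF : ProperFilter F.
  split; first by move=> [t ut /(_ t ut)]; exact.
  split=> [|U V [t ut tU] [v uv vV]|U V UV [t ut tU]].
  - by exists [::].
  - exists (undup (t ++ v)) => [|w uw tw]; first exact: undup_uniq.
    split; [apply: tU => // g gt|apply: vV => // g gv]; apply: tw.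
      by rewrite mem_undup mem_cat gt.
    by rewrite mem_undup mem_cat gv orbT.
  - by exists t => // v uv tv; apply: UV; exact: tU.
have [|b Fb] := rapid_complete tau1 FF.
  move=> U /(rapid_nbhsP tau1)[r [e [e0 eU]]].
  have [s [C [C0 uC]]] := uB r.
  have C10 : 0 < C + 1 by rewrite ltr_wpDl.
  (* Two truncations, of [v] and of [v'], each leave a tail of half the allowed size; [C + 1] avoids
     a zero denominator. *)
  have e'0 : 0 < e / (C + 1) / 2 by rewrite !divr_gt0.
  have [t ut tP] := rapid_norm_tail s a e'0.
  exists [set psum v a | v in [set v | uniq v /\ {subset t <= v}]].
    by exists t => // v uv tv; exists v.
  move=> _ _ [v [uv tv] <-] [v' [uv' tv'] <-]; apply: eU; rewrite subr0.
  pose w := undup (v ++ v'); have uw : uniq w by exact: undup_uniq.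
  rewrite -(psum_trunc a uv uw); last first.
    by move=> g gv; rewrite mem_undup mem_cat gv.
  rewrite -(psum_trunc a uv' uw); last first.
    by move=> g gv; rewrite mem_undup mem_cat gv orbT.
  rewrite addrC -scaleN1r -psum_linear scaleN1r addrC.
  apply: le_lt_trans (psum_bound _ C0 uw uC) _.
  have : rapid_norm s (trunc v a - trunc v' a) < e / (C + 1).
    rewrite -(subrKA a) (splitr (e / _)).
    apply: le_lt_trans (rapid_normD _ _ _) _; apply: ltrD; last exact: tP.
    by rewrite (seminormB (rapid_norm_seminorm s)); exact: tP.
  rewrite ltr_pdivlMr// => /(le_lt_trans _); apply.
  by rewrite mulrC ler_wpM2l ?rapid_norm_ge0// lerDl.
exists b => r e e0.
have /Fb[t ut tP] : nbhs b [set c | rapid_norm r (c - b) < e].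
  by apply/(rapid_nbhsP tau1); exists r, e.
exists t => // v uv tv; rewrite (seminormB (rapid_norm_seminorm r)).
exact: tP.
Qed.

Let has_sum_unique a b b' : has_sum a b -> has_sum a b' -> b = b'.
Proof.
move=> ab ab'; apply/eqP; rewrite -subr_eq0; apply/eqP.
apply: (rapid_norm_eq0 tau1) => e e0; have e20 : 0 < e / 2 by rewrite divr_gt0.
have [t ut tP] := ab 0%:nng _ e20; have [t' ut' tP'] := ab' 0%:nng _ e20.
pose w := undup (t ++ t'); have uw : uniq w by exact: undup_uniq.
rewrite -(subrKA (psum w a)) (splitr e).
apply: le_lt_trans (rapid_normD _ _ _) _; apply: ltrD.
  by apply: tP => // g gt; rewrite mem_undup mem_cat gt.
rewrite (seminormB (rapid_norm_seminorm _)).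
by apply: tP' => // g gt; rewrite mem_undup mem_cat gt orbT.
Qed.

Lemma bounded_linear_extension : exists f : A -> B,
  bounded_linear f /\ forall g, f (delta L sigma g) = u g.
Proof.
have /choice[f fP] := has_sum_ex; exists f; split; first split.
- move=> k a b; apply: has_sum_unique (fP _) _ => r e e0.
  have k10 : 0 < normc k + 1 by rewrite ltr_wpDl ?normc_ge0.
  have e20 : 0 < e / 2 by rewrite divr_gt0.
  have [|t ut tP] := fP a r (e / 2 / (normc k + 1)); first by rewrite divr_gt0.
  have [t' ut' tP'] := fP b r _ e20.
  exists (undup (t ++ t')); first exact: undup_uniq.
  move=> w uw tw; rewrite psum_linear opprD addrACA -scalerBr (splitr e).
  apply: le_lt_trans (rapid_normD _ _ _) _; apply: ltrD; last first.
    by apply: tP' => // g gt; apply: tw; rewrite mem_undup mem_cat gt orbT.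
  rewrite rapid_normZ; have : rapid_norm r (f a - psum w a) < e / 2 / (normc k + 1).
    by apply: tP => // g gt; apply: tw; rewrite mem_undup mem_cat gt.
  rewrite ltr_pdivlMr// => /(le_lt_trans _); apply.
  by rewrite mulrC ler_wpM2l ?rapid_norm_ge0// lerDl.
- move=> r; have [s [C [C0 uC]]] := uB r; exists s, C; split=> // a.
  apply/ler_addgt0Pr => e e0; have [t ut tP] := fP a r e e0.
  rewrite -(subrK (psum t a) (f a)) addrC.
  apply: le_trans (rapid_normD _ _ _) _; apply: lerD; last by apply/ltW/tP.
  exact: psum_bound.
- move=> g; apply: has_sum_unique (fP _) _ => r e e0; exists [:: g] => // v uv gv.
  rewrite /psum (bigD1_seq g)//=; last by apply: gv; rewrite inE.
  rewrite big1 => [|h /negbTE hg]; last first.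
    by rewrite -[X in X *: _]/((h == g)%:R) hg scale0r.
  by rewrite -[X in X *: _]/((g == g)%:R) eqxx scale1r addr0 subrr rapid_norm0.
Qed.

End extension.

End one_map.

(** * Composition of bounded maps and bounded bilinear maps *)

Section composition.
Variables (G H K : groupType) (L : G -> nat) (M : H -> nat) (P : K -> nat).
Variables (sigma tau ups : nat -> R).
Hypotheses (sigma1 : forall n, 1 <= sigma n) (tau1 : forall n, 1 <= tau n).
Hypothesis (ups1 : forall n, 1 <= ups n).
Local Notation A := (rapid L sigma).
Local Notation B := (rapid M tau).
Local Notation D := (rapid P ups).

Lemma bounded_linear_comp (f : A -> B) (f' : B -> D) :
  bounded_linear f -> bounded_linear f' -> bounded_linear (f' \o f).
Proof.
move=> [lf bf] [lf' bf']; split=> [k a b|r]; first by rewrite /= lf lf'.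
have [s' [C' [C'0 fC']]] := bf' r; have [s [C [C0 fC]]] := bf s'.
exists s, (C' * C); split=> [|a]; first exact: mulr_ge0.
by apply: le_trans (fC' _) _; rewrite -mulrA ler_wpM2l.
Qed.

Lemma bounded_bilinear_left (f : A -> B -> D) b :
  bounded_bilinear f -> bounded_linear (f^~ b).
Proof.
move=> [lf _ bf]; split=> // r; have [s [t [C [C0 fC]]]] := bf r.
exists s, (C * rapid_norm t b); split=> [|a].
  by rewrite mulr_ge0 ?rapid_norm_ge0.
by rewrite mulrAC.
Qed.

Lemma bounded_bilinear_right (f : A -> B -> D) a :
  bounded_bilinear f -> bounded_linear (f a).
Proof.
move=> [_ lf bf]; split=> // r; have [s [t [C [C0 fC]]]] := bf r.
exists t, (C * rapid_norm s a); split=> //.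
by rewrite mulr_ge0 ?rapid_norm_ge0.
Qed.

Lemma bounded_bilinear_comp (E : groupType) (Q : E -> nat) (rho : nat -> R)
    (f : A -> B -> D) (h : D -> rapid Q rho) :
  bounded_bilinear f -> bounded_linear h -> bounded_bilinear (fun a b => h (f a b)).
Proof.
move=> [lf lf' bf] [lh bh]; split.
- by move=> b k x y; rewrite lf lh.
- by move=> a k x y; rewrite lf' lh.
move=> r; have [q [C' [C'0 hC]]] := bh r; have [s [t [C [C0 fC]]]] := bf q.
exists s, t, (C' * C); split=> [|a b]; first exact: mulr_ge0.
apply: le_trans (hC _) _; rewrite -!mulrA ler_wpM2l//.
by rewrite mulrA.
Qed.

(** Only separate boundedness is asked for, so that for the composites in the Hopf axioms it can be
    assembled from compositions, one variable at a time. *)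
Lemma bounded_bilinear_ext (f f' : A -> B -> D) :
  (forall b, bounded_linear (f^~ b)) -> (forall a, bounded_linear (f a)) ->
  (forall b, bounded_linear (f'^~ b)) -> (forall a, bounded_linear (f' a)) ->
  (forall g h, f (delta L sigma g) (delta M tau h) =
               f' (delta L sigma g) (delta M tau h)) ->
  forall a b, f a b = f' a b.
Proof.
move=> fl fr fl' fr' ff' a b.
apply: (bounded_linear_ext sigma1 ups1 (fl b) (fl' b)) => g.
by apply: (bounded_linear_ext tau1 ups1 (fr _) (fr' _)) => h.
Qed.

Lemma bounded_bilinear_continuous (f : A -> B -> D) :
  bounded_bilinear f -> jointly_continuous f.
Proof.
move=> [lf lf' bf] [a b] U /(rapid_nbhsP ups1)[r [e [e0 eU]]].
have [s [t [C [C0 fC]]]] := bf r.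
(* For increments below [d], the two terms of the telescoped difference add up to at most
   [d * K0 - d]; the last summand 1 makes [K0] positive. The bound [d <= 1] keeps the norm of [y]
   below that of [b] plus 1. *)
pose K0 := C * (rapid_norm s a + rapid_norm t b + 1) + 1.
have K0p : 0 < K0.
  by rewrite ltr_wpDl// mulr_ge0// !addr_ge0// rapid_norm_ge0.
pose d := Num.min 1 (e / K0 / 2).
have d0 : 0 < d by rewrite lt_min ltr01 !divr_gt0.
exists ([set x | rapid_norm s (x - a) < d], [set y | rapid_norm t (y - b) < d]).
  split; first by apply/(rapid_nbhsP sigma1); exists s, d.
  by apply/(rapid_nbhsP tau1); exists t, d.
move=> [x y] /= [xa yb]; apply: eU.
have -> : f x y - f a b = f (x - a) y + f a (y - b).
  by rewrite (zmod_morphism_linear (lf y)) (zmod_morphism_linear (lf' a)) subrKA.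
apply: le_lt_trans (rapid_normD _ _ _) _.
have d1 : d <= 1 by rewrite ge_min lexx.
have dK : d * K0 <= e / 2.
  by rewrite -ler_pdivlMr// mulrAC ge_min lexx orbT.
have yn : rapid_norm t y <= rapid_norm t b + 1.
  rewrite -{1}(subrK b y) addrC; apply: le_trans (rapid_normD _ _ _) _.
  by rewrite lerD2l (le_trans (ltW yb)).
have h1 : rapid_norm r (f (x - a) y) <= C * d * (rapid_norm t b + 1).
  apply: le_trans (fC _ _) _; rewrite -!mulrA ler_wpM2l// ler_pM ?rapid_norm_ge0//.
  exact: ltW.
have h2 : rapid_norm r (f a (y - b)) <= C * rapid_norm s a * d.
  apply: le_trans (fC _ _) _; rewrite ler_wpM2l ?mulr_ge0 ?rapid_norm_ge0//.
  exact: ltW.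
have : C * d * (rapid_norm t b + 1) + C * rapid_norm s a * d + d = d * K0.
  by rewrite /K0; ring.
lra.
Qed.

End composition.
End bounded_maps.

(** * Elementary tensors *)

Section continuous_seminorms.
Context (R : realType) (G : groupType) (L : G -> nat) (sigma : nat -> R).
Hypothesis sigma1 : forall n, 1 <= sigma n.
Local Notation A := (rapid L sigma).
Implicit Types (a b : A) (r : {nonneg R}) (C e : R).

Lemma normc_real (k : R) : 0 <= k -> normc k%:C%C = k.
Proof. by move=> k0; rewrite /= expr0n addr0 sqrtr_sqr ger0_norm. Qed.

Lemma seminorm_bound (p : A -> R) : is_seminorm p ->
  nbhs 0 [set a | p a < 1] ->
  exists r C, 0 < C /\ forall a, p a <= C * rapid_norm r a.
Proof.
move=> pP /(rapid_nbhsP sigma1)[r [e [e0 eU]]].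
exists r, (2 / e); split=> [|a]; first by rewrite divr_gt0.
apply/ler_addgt0Pr => d d0.
have Na := rapid_norm_ge0 r a.
(* The added term keeps [m] positive when the norm of [a] vanishes; multiplied by [2 / e] it becomes
   the slack [d]. Scaling [a] by [e / 2 / m] brings it into the ball of radius [e]. *)
pose m := rapid_norm r a + d * (e / 2).
have m0 : 0 < m by rewrite ltr_wpDl// mulr_gt0// divr_gt0.
have k0 : 0 <= e / 2 / m by rewrite divr_ge0 ?(ltW m0)// divr_ge0// ltW.
have := eU ((e / 2 / m)%:C%C *: a).
rewrite subr0 rapid_normZ normc_real//= pP.2 normc_real//.
have -> : 2 / e * rapid_norm r a + d = 2 / e * m.
  by rewrite /m; field; exact: lt0r_neq0.
have -> : e / 2 / m * p a = p a / (2 / e * m).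
  by field; rewrite !lt0r_neq0.
rewrite ltr_pdivrMr ?mul1r ?mulr_gt0 ?invr_gt0// => h; apply/ltW/h.
have nm : rapid_norm r a < m by rewrite ltrDl mulr_gt0// divr_gt0.
have -> : e / 2 / m * rapid_norm r a = e / 2 * rapid_norm r a / m by ring.
by rewrite ltr_pdivrMr//; nra.
Qed.

Lemma continuous_seminorm_bound (p : A -> R) : continuous_seminorm p ->
  exists r C, 0 < C /\ forall a, p a <= C * rapid_norm r a.
Proof.
move=> [pP pc]; apply: seminorm_bound => //.
have /cvgrPdist_lt/(_ 1 ltr01) := pc 0.
apply: filterS => a /=; rewrite (seminorm0 pP) sub0r normrN.
by rewrite ger0_norm// (seminorm_ge0 pP).
Qed.

Lemma continuous_scaled_rapid_norm r C : 0 < C ->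
  continuous_seminorm (fun a : A => C * rapid_norm r a).
Proof.
move=> C0; split; first split=> [a b|k a].
- by rewrite -mulrDr ler_pM2l// rapid_normD.
- by rewrite rapid_normZ mulrCA.
move=> a U /nbhs_ballP[e /= e0 eU]; apply/(rapid_nbhsP sigma1).
exists r, (e / C); split=> [|b ba]; first by rewrite divr_gt0.
apply: eU; rewrite -ball_normE /= -mulrBr normrM (gtr0_norm C0) mulrC -ltr_pdivlMr//.
apply: le_lt_trans _ ba; rewrite ler_norml.
have := rapid_normD r (b - a) a; have := rapid_normD r (a - b) b.
rewrite (seminormB (rapid_norm_seminorm r) a) !subrK => ? ?.
by apply/andP; split; lra.
Qed.

End continuous_seminorms.

Section tensor_weights.
Context (R : realType) (G H : Type).

(* The weight of (g, h) is [sigma (L g) * tau (M h)]; as weights have to factor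
   through [nat], the pair of lengths is encoded by a single number. *)
Definition tensor_length (L : G -> nat) (M : H -> nat) (x : G * H) : nat :=
  pickle (L x.1, M x.2).

(** Numbers that encode no pair get the value 1, which keeps the weight at least 1 everywhere. *)
Definition tensor_growth (sigma tau : nat -> R) (n : nat) : R :=
  if unpickle n is Some (i, j) then sigma i * tau j else 1.

Lemma tensor_growthE L M sigma tau x :
  tensor_growth sigma tau (tensor_length L M x) = sigma (L x.1) * tau (M x.2).
Proof. by rewrite /tensor_growth /tensor_length pickleK. Qed.

Lemma tensor_growth_ge1 sigma tau : (forall n, 1 <= sigma n) ->
  (forall n, 1 <= tau n) -> forall n, 1 <= tensor_growth sigma tau n.
Proof.
move=> s1 t1 n; rewrite /tensor_growth; case: unpickle => [[i j]|] //.
by rewrite -[leLHS]mulr1 ler_pM.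
Qed.

End tensor_weights.

Section rapid_tensor.
Context (R : realType) (G H : groupType) (L : G -> nat) (M : H -> nat).
Variables (sigma tau : nat -> R).
Local Notation A := (rapid L sigma).
Local Notation B := (rapid M tau).
Local Notation T := (rapid (tensor_length L M) (tensor_growth sigma tau)).
Hypotheses (sigma1 : forall n, 1 <= sigma n) (tau1 : forall n, 1 <= tau n).
Implicit Types (a : A) (b : B) (z : T) (r : {nonneg R}).

Definition tensor_fun a b (x : G * H) : R[i]^o := a x.1 * b x.2.

Lemma tensor_weightE (x : G * H) (r : R) :
  tensor_growth sigma tau (tensor_length L M x) `^ r =
  sigma (L x.1) `^ r * tau (M x.2) `^ r.
Proof. by rewrite tensor_growthE powRM// (le_trans ler01). Qed.

(** A finite set of pairs lies in the rectangle spanned by its projections, over which the sum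
    factors. *)
Lemma tensor_fun_sum a b r (s : seq (G * H)) : uniq s ->
  \sum_(x <- s) normc (tensor_fun a b x) *
    tensor_growth sigma tau (tensor_length L M x) `^ r%:num <=
  rapid_norm r a * rapid_norm r b.
Proof.
move=> us; pose t := undup [seq x.1 | x <- s]; pose v := undup [seq x.2 | x <- s].
have ut : uniq t by exact: undup_uniq.
have uv : uniq v by exact: undup_uniq.
pose F x := normc (tensor_fun a b x) *
  tensor_growth sigma tau (tensor_length L M x) `^ r%:num.
apply: (@le_trans _ _ (\sum_(x <- [seq (g, h) | g <- t, h <- v]) F x)).
  apply: ler_sum_uniq => //.
  - by move=> x; rewrite mulr_ge0 ?powR_ge0 ?normc_ge0.
  - by apply: allpairs_uniq => // -[? ?] [? ?].
  - move=> x xs; apply/allpairsP; exists x; rewrite !mem_undup.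
    by rewrite !map_f//; case: x {xs}.
rewrite big_allpairs/=; apply: le_trans
    (ler_pM _ _ (rapid_norm_sum r a ut) (rapid_norm_sum r b uv)); last 2 first.
- by apply: sumr_ge0 => g _; rewrite mulr_ge0 ?powR_ge0 ?normc_ge0.
- by apply: sumr_ge0 => g _; rewrite mulr_ge0 ?powR_ge0 ?normc_ge0.
rewrite big_distrl/=; apply: ler_sum => g _; rewrite big_distrr/=.
apply: ler_sum => h _.
by rewrite /F tensor_weightE normcM mulrACA.
Qed.

Lemma tensor_fun_rapid a b :
  tensor_fun a b \in rapid_pred (tensor_length L M) (tensor_growth sigma tau).
Proof.
rewrite inE => r r0; rewrite /ell1/=.
apply: (@le_lt_trans _ _
  (rapid_norm (NngNum r0) a * rapid_norm (NngNum r0) b)%:E); last exact: ltry.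
by apply: wnorm_le => s us; exact: (tensor_fun_sum a b (NngNum r0)).
Qed.

Definition rapid_tensor a b : T := Rapid (tensor_fun_rapid a b).

Lemma coeff_tensor a b x : rapid_tensor a b x = a x.1 * b x.2.
Proof. by []. Qed.

Lemma rapid_norm_tensor r a b :
  rapid_norm r (rapid_tensor a b) <= rapid_norm r a * rapid_norm r b.
Proof. by apply: rapid_norm_le => s us; exact: tensor_fun_sum. Qed.

Lemma rapid_tensor_delta g h :
  rapid_tensor (delta L sigma g) (delta M tau h) = delta _ _ (g, h).
Proof.
apply: rapidP => -[x y]; rewrite coeff_tensor !coeff_delta/= xpair_eqE.
by case: eqP => _; case: eqP => _; rewrite /= ?mulr1 ?mul0r ?mulr0.
Qed.

Lemma bilinear_rapid_tensor : bilinear_for *:%R *:%R rapid_tensor.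
Proof.
split=> [b|a] k x y; apply: rapidP => z; rewrite coeffD coeffZ !coeff_tensor.
  by rewrite coeffD coeffZ mulrDl mulrA.
by rewrite coeffD coeffZ mulrDr mulrCA.
Qed.

HB.instance Definition _ := bilinear_isBilinear.Build R[i] A B T *:%R *:%R
  rapid_tensor bilinear_rapid_tensor.

Lemma bounded_rapid_tensor : bounded_bilinear rapid_tensor.
Proof.
split=> [b|a|r]; [exact: bilinear_rapid_tensor.1|exact: bilinear_rapid_tensor.2|].
exists r, r, 1; split=> // a b; rewrite mul1r; exact: rapid_norm_tensor.
Qed.

End rapid_tensor.

Arguments bilinear_rapid_tensor {R G H L M sigma tau} sigma1 tau1.
Arguments bounded_rapid_tensor {R G H L M sigma tau} sigma1 tau1.
Arguments rapid_tensor_delta {R G H L M sigma tau} sigma1 tau1 g h.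

(** * The completed projective tensor product *)

Section rapid_cptensor.
Context (R : realType) (G H : groupType) (L : G -> nat) (M : H -> nat).
Variables (sigma tau : nat -> R).
Hypotheses (sigma1 : forall n, 1 <= sigma n) (tau1 : forall n, 1 <= tau n).
Local Notation A := (rapid L sigma).
Local Notation B := (rapid M tau).
Local Notation T := (rapid (tensor_length L M) (tensor_growth sigma tau)).
Local Notation tens := (rapid_tensor sigma1 tau1 : {bilinear A -> B -> T}).
Let T1 := tensor_growth_ge1 sigma1 tau1.
Implicit Types (x : A) (y : B) (z : T) (r : {nonneg R}) (s : seq (A * B)) (e : R).

Lemma coeff_tensor_sum s g h :
  tensor_sum tens s (g, h) = \sum_(xy <- s) xy.1 g * xy.2 h.
Proof. by rewrite coeff_sum. Qed.

Lemma tensor_sum_cons xy s :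
  tensor_sum tens (xy :: s) = tens xy.1 xy.2 + tensor_sum tens s.
Proof. by rewrite /tensor_sum big_cons. Qed.

Lemma tensor_sum_cat s t :
  tensor_sum tens (s ++ t) = tensor_sum tens s + tensor_sum tens t.
Proof. by rewrite /tensor_sum big_cat. Qed.

(** Finitely supported elements lie in the algebraic tensor product, with one elementary tensor per
    point. Both density and the cost estimate rest on this representation. *)
Lemma trunc_tensor_sum z (u : seq (G * H)) :
  trunc u z = tensor_sum tens
    [seq (z w *: delta L sigma w.1, delta M tau w.2) | w <- u].
Proof.
rewrite /tensor_sum big_map; apply: eq_bigr => -[g h] _ /=.
rewrite (linearZl_LR tens); congr (_ *: _).
exact: (esym (rapid_tensor_delta sigma1 tau1 g h)).
Qed.

Lemma tensor_sum_dense : dense (range (tensor_sum tens)).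
Proof.
move=> O [z Oz] oO; have /(rapid_nbhsP T1)[r [e [e0 eO]]] : nbhs z O.
  by apply: open_nbhs_nbhs; split.
have [u uu uP] := rapid_norm_tail r z e0.
exists (trunc u z); split; last first.
  by rewrite trunc_tensor_sum; eexists.
by apply: eO; rewrite (seminormB (rapid_norm_seminorm _)); exact: uP.
Qed.

(* If [y h != 0] then evaluating a vanishing sum [x (x) y + ...] at [h] expresses
   [x] through the other left factors, which removes one summand. *)
Lemma tensor_sum_algebraic (V : lmodType R[i]) (b : {bilinear A -> B -> V}) s :
  tensor_sum tens s = 0 -> \sum_(xy <- s) b xy.1 xy.2 = 0.
Proof.
move: {2}(size s) (erefl (size s)) => n; elim: n s => [|n ih] [|[x y] s] //=.
  by rewrite !big_nil.
move=> [sn]; have [->|y0] := eqVneq y 0.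
  rewrite /tensor_sum !big_cons/= !linear0r !add0r => s0.
  exact: ih.
move=> s0; have [h yh] : exists h, y h != 0.
  apply: contrapT => /forallNP yh; move/eqP: y0; apply.
  by apply: rapidP => h; apply/eqP; have /negP := yh h; rewrite negbK.
pose c (w : B) : R[i] := w h / y h.
have xE : x = - \sum_(xy <- s) c xy.2 *: xy.1.
  apply: rapidP => g; rewrite coeffN coeff_sum.
  have := congr1 (fun z => coeff z (g, h)) s0.
  rewrite coeff_tensor_sum big_cons/= => /eqP; rewrite addr_eq0 => /eqP xy.
  apply: (mulIf yh); rewrite xy mulNr; congr (- _); rewrite mulr_suml.
  by apply: eq_bigr => w _; rewrite -[in RHS]/(c w.2 * w.1 g) /c mulrAC divfK// mulrC.
pose s' := [seq (xy.1, xy.2 - c xy.2 *: y) | xy <- s].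
(* The target is arbitrary because the identity is used twice: for [b], and for [tens] to see that
   the shorter sum still vanishes. *)
have reduce (W : lmodType R[i]) (f : {bilinear A -> B -> W}) :
    \sum_(xy <- (x, y) :: s) f xy.1 xy.2 = \sum_(xy <- s') f xy.1 xy.2.
  rewrite big_cons/= xE linearNl linear_sumlz big_map/= -sumrN -big_split/=.
  by apply: eq_bigr => -[x' y'] _ /=; rewrite linearBr linearZl_LR linearZr_LR addrC.
rewrite reduce; apply: ih; first by rewrite size_map.
by rewrite /tensor_sum -reduce.
Qed.

Let cost r s := \sum_(xy <- s) rapid_norm r xy.1 * rapid_norm r xy.2.

(** Each summand splits as x ⊗ y = (x - x') ⊗ y + x' ⊗ (y - y') + x' ⊗ y' with truncations x' and
    y', and the first two terms are cheap. All larger index sets are allowed so that one pair of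
    sets serves every summand in the induction. *)
Let tensor_sum_trunc r s e : 0 < e -> exists t v, [/\ uniq t, uniq v &
  forall t' v', uniq t' -> uniq v' -> {subset t <= t'} -> {subset v <= v'} ->
  exists s', cost r s' <= e /\ tensor_sum tens s =
    tensor_sum tens s' + tensor_sum tens [seq (trunc t' xy.1, trunc v' xy.2) | xy <- s]].
Proof.
elim: s e => [|[x y] s ih] e e0.
  exists [::], [::]; split=> // t' v' _ _ _ _; exists [::].
  by rewrite /cost /tensor_sum !big_nil addr0 ltW.
have e20 : 0 < e / 2 by rewrite divr_gt0.
have [t [v [ut uv tvP]]] := ih _ e20.
have x1 : 0 < rapid_norm r x + 1 by rewrite ltr_wpDl ?rapid_norm_ge0.
have y1 : 0 < rapid_norm r y + 1 by rewrite ltr_wpDl ?rapid_norm_ge0.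
(* Half of [e] goes to the remaining summands and a quarter to each of the two error tensors,
   divided by a bound on the other factor. *)
have [|t1 ut1 tP1] := rapid_norm_tail r x (e := e / 2 / 2 / (rapid_norm r y + 1)).
  by rewrite !divr_gt0.
have [|v1 uv1 vP1] := rapid_norm_tail r y (e := e / 2 / 2 / (rapid_norm r x + 1)).
  by rewrite !divr_gt0.
exists (undup (t ++ t1)), (undup (v ++ v1)); split; try exact: undup_uniq.
move=> t' v' ut' uv' tt' vv'.
have [||s' [s'e sE]] := tvP t' v' ut' uv'.
- by move=> g gt; apply: tt'; rewrite mem_undup mem_cat gt.
- by move=> g gt; apply: vv'; rewrite mem_undup mem_cat gt.
have xt : rapid_norm r (x - trunc t' x) < e / 2 / 2 / (rapid_norm r y + 1).
  by apply: tP1 => // g gt; apply: tt'; rewrite mem_undup mem_cat gt orbT.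
have yt : rapid_norm r (y - trunc v' y) < e / 2 / 2 / (rapid_norm r x + 1).
  by apply: vP1 => // g gt; apply: vv'; rewrite mem_undup mem_cat gt orbT.
exists ((x - trunc t' x, y) :: (trunc t' x, y - trunc v' y) :: s'); split.
  rewrite /cost !big_cons/= addrA (splitr e) lerD// (splitr (e / 2)) lerD//.
    rewrite ltr_pdivlMr// in xt; apply: le_trans _ (ltW xt).
    by rewrite ler_wpM2l ?rapid_norm_ge0// lerDl.
  rewrite ltr_pdivlMr// in yt; apply: le_trans _ (ltW yt).
  rewrite mulrC ler_wpM2l ?rapid_norm_ge0//.
  by apply: le_trans (rapid_norm_trunc r x ut') _; rewrite lerDl.
rewrite map_cons !tensor_sum_cons [fst _]/= [snd _]/= sE.
have -> : tens x y = tens (x - trunc t' x) y + tens (trunc t' x) (y - trunc v' y) +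
    tens (trunc t' x) (trunc v' y).
  by rewrite (linearBl tens) (linearBr tens) subrKA subrK.
rewrite -!addrA; congr (_ + (_ + _)); exact: addrCA.
Qed.

(** The harder half of the identity between the projective norm and the weighted l^1 norm. Since the
    weight of a pair is the product of the weights, the basis expansion of a finitely supported
    tensor costs at most its norm. *)
Lemma tensor_sum_cost r s e : 0 < e -> exists s',
  tensor_sum tens s' = tensor_sum tens s /\
  \sum_(xy <- s') rapid_norm r xy.1 * rapid_norm r xy.2 <=
    rapid_norm r (tensor_sum tens s) + e.
Proof.
move=> e0; have [t [v [ut uv /(_ t v ut uv)[]//]]] := tensor_sum_trunc r s e0.
move=> s' [s'e sE].
pose z := tensor_sum tens s; pose u := [seq (g, h) | g <- t, h <- v].
have uu : uniq u by apply: allpairs_uniq => // -[? ?] [? ?].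
(* The cheap remainder, followed by the basis expansion of [z] on the rectangle [u]; truncating both
   factors of every summand is the same as restricting [z] to [u]. *)
exists (s' ++ [seq (z w *: delta L sigma w.1, delta M tau w.2) | w <- u]).
split.
  rewrite tensor_sum_cat -trunc_tensor_sum [RHS]sE; congr (_ + _).
  apply: rapidP => -[g h]; rewrite coeff_trunc// coeff_tensor_sum big_map/=.
  rewrite (_ : (g, h) \in u = (g \in t) && (h \in v)); last first.
    apply/allpairsP/andP => [[[g' h'] [/= gt hv [-> ->]]]|[gt hv]] //.
    by exists (g, h).
  case: ifPn => [/andP[gt hv]|].
    by rewrite /z coeff_tensor_sum; apply: eq_bigr => xy _; rewrite !coeff_trunc// gt hv.
  rewrite negb_and => ghtv; rewrite big1// => xy _; rewrite !coeff_trunc//.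
  by case/orP: ghtv => /negbTE ->; rewrite ?mul0r ?mulr0.
rewrite big_cat/= addrC lerD// big_map; apply: le_trans (rapid_norm_sum r z uu).
apply: ler_sum => w _ /=; rewrite rapid_normZ tensor_weightE// -mulrA.
by rewrite ler_wpM2l ?normc_ge0// ler_pM ?rapid_norm_ge0// rapid_norm_delta.
Qed.

Lemma rapid_norm_tensor_sum r s : rapid_norm r (tensor_sum tens s) <=
  \sum_(xy <- s) rapid_norm r xy.1 * rapid_norm r xy.2.
Proof.
rewrite /tensor_sum; elim: s => [|xy s ih]; first by rewrite !big_nil rapid_norm0.
rewrite !big_cons; apply: le_trans (rapid_normD _ _ _) _; rewrite lerD//.
exact: rapid_norm_tensor.
Qed.

Lemma tensor_sum_topology (U : set T) :
  (exists2 V, nbhs (0 : T) V & V `&` range (tensor_sum tens) `<=` U) <->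
  (exists p q, [/\ continuous_seminorm p, continuous_seminorm q &
     [set z | projective_seminorm tens p q z < 1] `&` range (tensor_sum tens)
       `<=` U]).
Proof.
split=> [[V /(rapid_nbhsP T1)[r [e [e0 eV]]] VU]|[p [q [pc qc pqU]]]].
  (* A cost below 1 for these two seminorms is a cost below [e] for the norm of exponent [r]. *)
  exists (fun x => e^-1 * rapid_norm r x), (fun y => 1 * rapid_norm r y); split.
  - by apply: continuous_scaled_rapid_norm => //; rewrite invr_gt0.
  - exact: continuous_scaled_rapid_norm.
  move=> z [/= z1 zr]; apply: VU; split=> //; apply: eV; rewrite subr0.
  have [|_ [s -> ->]] := inf_lt _ z1.
    by have [s _ <-] := zr; eexists; exists s.
  rewrite (eq_bigr (fun xy => e^-1 * (rapid_norm r xy.1 * rapid_norm r xy.2)));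
    last by move=> xy _; rewrite mul1r mulrA.
  rewrite -mulr_sumr mulrC ltr_pdivrMr// mul1r.
  by apply: le_lt_trans; exact: rapid_norm_tensor_sum.
have [r1 [C [C0 pC]]] := continuous_seminorm_bound sigma1 pc.
have [r2 [D [D0 qD]]] := continuous_seminorm_bound tau1 qc.
have m0 : 0 <= Num.max r1%:num r2%:num by rewrite le_max ge0.
pose r := NngNum m0.
(* Half of the inverse of [C * D] bounds the norm of [z]; the other half is the excess cost allowed
   for its representation. *)
have CD : 0 < 1 / 2 / (C * D) by rewrite !divr_gt0// mulr_gt0.
exists [set z | rapid_norm r z < 1 / 2 / (C * D)].
  by apply/(rapid_nbhsP T1); exists r, (1 / 2 / (C * D)); split=> // b; rewrite subr0.
move=> z [/= zr [s _ sz]]; apply: pqU; split=> /=; last by exists s.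
have [s' [s'z s'c]] := tensor_sum_cost r s CD.
apply: (@le_lt_trans _ _ (\sum_(xy <- s') p xy.1 * q xy.2)).
  apply: ge_inf; last by exists s' => //; rewrite s'z sz.
  exists 0 => _ [s'' _ ->]; apply: sumr_ge0 => xy _.
  by rewrite mulr_ge0 ?(seminorm_ge0 pc.1) ?(seminorm_ge0 qc.1).
apply: (@le_lt_trans _ _ (C * D *
    \sum_(xy <- s') rapid_norm r xy.1 * rapid_norm r xy.2)).
  rewrite mulr_sumr; apply: ler_sum => xy _; rewrite mulrACA.
  apply: ler_pM; rewrite ?(seminorm_ge0 pc.1) ?(seminorm_ge0 qc.1)//.
    apply: le_trans (pC _) _; rewrite ler_pM2l//; apply: rapid_norm_mono => //.
    by rewrite /= le_max lexx.
  apply: le_trans (qD _) _; rewrite ler_pM2l//; apply: rapid_norm_mono => //.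
  by rewrite /= le_max lexx orbT.
rewrite mulrC -ltr_pdivlMr ?mulr_gt0//; apply: le_lt_trans s'c _.
rewrite sz [ltRHS](_ : _ = 1 / 2 / (C * D) + 1 / 2 / (C * D)) ?ltrD2r//.
by rewrite -mulrDl -splitr.
Qed.

Lemma rapid_tensorP : is_completed_projective_tensor tens.
Proof.
split.
- exact: rapid_hausdorff T1.
- exact: rapid_complete T1.
- exact: tensor_sum_algebraic.
- exact: tensor_sum_dense.
- exact: tensor_sum_topology.
Qed.

Definition rapid_cptensor : cptensor A B := CPTensor rapid_tensorP.

End rapid_cptensor.

(** * Push-forwards *)

Section tame_maps.
Context (R : realType).
Implicit Types (C D : R) (p q : {nonneg R}).

Definition tame (G H : Type) (L : G -> nat) (M : H -> nat)
    (sigma tau : nat -> R) (f : G -> H) : Prop :=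
  exists p C, 0 <= C /\ forall g, tau (M (f g)) <= C * sigma (L g) `^ p%:num.

Variables (G H K : Type) (L : G -> nat) (M : H -> nat) (P : K -> nat).
Variables (sigma tau ups : nat -> R).
Hypotheses (sigma1 : forall n, 1 <= sigma n) (tau1 : forall n, 1 <= tau n).
Hypothesis (ups1 : forall n, 1 <= ups n).

Lemma tame_comp (f : G -> H) (h : H -> K) :
  tame L M sigma tau f -> tame M P tau ups h -> tame L P sigma ups (h \o f).
Proof.
move=> [p [C [C0 fC]]] [q [D [D0 hD]]].
exists (p%:num * q%:num)%:nng, (D * C `^ q%:num); split=> [|g].
  by rewrite mulr_ge0 ?powR_ge0.
apply: le_trans (hD _) _; rewrite -mulrA ler_wpM2l//= powRrM -powRM ?powR_ge0//.
apply: ge0_ler_powR => //; rewrite ?nnegrE ?mulr_ge0 ?powR_ge0//.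
exact: le_trans ler01 _.
Qed.

Lemma tame_pair (f : G -> H) (h : G -> K) :
  tame L M sigma tau f -> tame L P sigma ups h ->
  tame L (tensor_length M P) sigma (tensor_growth tau ups) (fun g => (f g, h g)).
Proof.
move=> [p [C [C0 fC]]] [q [D [D0 hD]]].
exists (p%:num + q%:num)%:nng, (C * D); split=> [|g]; first exact: mulr_ge0.
rewrite tensor_growthE/= powRD; last first.
  by rewrite [_ != 0]lt0r_neq0 ?implybT// (lt_le_trans ltr01).
by rewrite mulrACA ler_pM// (le_trans ler01).
Qed.

Lemma tame_id : tame L L sigma sigma id.
Proof. by exists 1%:nng, 1; split=> // g; rewrite mul1r powRr1// (le_trans ler01). Qed.

Lemma tame_const (h : H) : tame L M sigma tau (fun=> h).
Proof.
exists 0%:nng, (tau (M h)); split=> [|g]; first exact: le_trans ler01 _.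
by rewrite powRr0 mulr1.
Qed.

Lemma tame_fst :
  tame (tensor_length L M) L (tensor_growth sigma tau) sigma fst.
Proof.
exists 1%:nng, 1; split=> // -[g h]; rewrite mul1r tensor_growthE/= powRr1.
  by rewrite ler_peMr// (le_trans ler01).
by rewrite mulr_ge0// (le_trans ler01).
Qed.

Lemma tame_snd :
  tame (tensor_length L M) M (tensor_growth sigma tau) tau snd.
Proof.
exists 1%:nng, 1; split=> // -[g h]; rewrite mul1r tensor_growthE/= powRr1.
  by rewrite ler_peMl// (le_trans ler01).
by rewrite mulr_ge0// (le_trans ler01).
Qed.

End tame_maps.

Section pushforward.
Context (R : realType) (G H : groupType) (L : G -> nat) (M : H -> nat).
Variables (sigma tau : nat -> R).
Hypotheses (sigma1 : forall n, 1 <= sigma n) (tau1 : forall n, 1 <= tau n).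
Local Notation A := (rapid L sigma).
Local Notation B := (rapid M tau).

Definition pushes (f : G -> H) (F : A -> B) : Prop :=
  bounded_linear F /\ forall g, F (delta L sigma g) = delta M tau (f g).

(** A power of the weight is harmless: exponent [r] on the target is absorbed by exponent [p * r] on
    the source. *)
Lemma pushforward (f : G -> H) : tame L M sigma tau f -> exists F, pushes f F.
Proof.
move=> [p [C [C0 fC]]]; apply: bounded_linear_extension => // r.
exists (p%:num * r%:num)%:nng, (C `^ r%:num); split=> [|g]; first exact: powR_ge0.
apply: le_trans (rapid_norm_delta _ _ _ _) _.
rewrite /= powRrM -powRM ?powR_ge0//; apply: ge0_ler_powR => //.
- by rewrite nnegrE (le_trans ler01).
- by rewrite nnegrE mulr_ge0 ?powR_ge0.
Qed.

(** Multiplying a coefficient functional by a fixed vector makes it a map between such spaces, so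
    that scalar identities can be checked on the basis too. *)
Lemma bounded_linear_coeff (F : A -> B) (h : H) (K : groupType) (P : K -> nat)
    (ups : nat -> R) (v : rapid P ups) :
  bounded_linear F -> bounded_linear (fun a => F a h *: v).
Proof.
move=> [lF bF]; split=> [k a b|r].
  by rewrite lF coeffD coeffZ scalerDl scalerA.
have [s [C [C0 FC]]] := bF 0%:nng; exists s, (C * rapid_norm r v).
split=> [|a]; first by rewrite mulr_ge0 ?rapid_norm_ge0.
rewrite rapid_normZ mulrAC ler_wpM2r ?rapid_norm_ge0//.
exact: le_trans (normc_coeff_le tau1 _ _ _) (FC _).
Qed.

Lemma continuous_coeff (g : G) : continuous (fun a : A => a g).
Proof.
move=> a U /nbhs_ballP[e /= e0 eU]; apply/(rapid_nbhsP sigma1).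
(* Balls in [R[i]] have radii in [R[i]]; a positive radius is real. *)
have eE : e = (complex.Re e)%:C%C.
  by move: e0; case: e {eU} => x y; rewrite ltcE/= => /andP[/eqP ->].
have e'0 : 0 < complex.Re e by move: e0; rewrite eE ltcR.
exists 0%:nng, (complex.Re e); split=> // b ba; apply: eU.
rewrite -ball_normE /ball_/= eE -[ltLHS]/((normc (a g - b g))%:C%C) ltcR.
rewrite -normcN opprB; apply: le_lt_trans _ ba.
exact: (normc_coeff_le sigma1 _ (b - a)).
Qed.

End pushforward.

(** * Complex conjugation of coefficients *)

Section conjugation.
Context (R : realType) (G : groupType) (L : G -> nat) (sigma : nat -> R).
Local Notation A := (rapid L sigma).

Let wnorm_conj r (a : G -> R[i]^o) :
  wnorm L sigma r (fun g => conjc (a g)) = wnorm L sigma r a.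
Proof. by apply: eq_esum => g _; rewrite normc_conj. Qed.

Lemma conj_fun_rapid (a : A) : (fun g => conjc (a g)) \in rapid_pred L sigma.
Proof.
rewrite inE => r r0; rewrite /ell1/= wnorm_conj.
by have := coeffP a; rewrite inE; apply.
Qed.

Definition rapid_conj (a : A) : A := Rapid (conj_fun_rapid a).

Lemma coeff_conj a g : rapid_conj a g = conjc (a g).
Proof. by []. Qed.

Lemma rapid_norm_conj r a : rapid_norm r (rapid_conj a) = rapid_norm r a.
Proof. by apply: EFin_inj; rewrite !rapid_normE wnorm_conj. Qed.

Lemma rapid_conjP : conj_linear rapid_conj.
Proof. by move=> k a b; apply: rapidP => g; rewrite /= rmorphD rmorphM. Qed.

Lemma rapid_conjK : involutive rapid_conj.
Proof. by move=> a; apply: rapidP => g; rewrite !coeff_conj conjcK. Qed.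

Lemma rapid_conj_delta g : rapid_conj (delta L sigma g) = delta L sigma g.
Proof. by apply: rapidP => h; rewrite coeff_conj coeff_delta rmorph_nat. Qed.

Lemma continuous_rapid_conj : (forall n, 1 <= sigma n) -> continuous rapid_conj.
Proof.
move=> s1 a U /(rapid_nbhsP s1)[r [e [e0 eU]]]; apply/(rapid_nbhsP s1).
exists r, e; split=> // b ba; apply: eU.
have -> : rapid_conj b - rapid_conj a = rapid_conj (b - a).
  by apply: rapidP => g; rewrite coeffB !coeff_conj coeffB rmorphB.
by rewrite rapid_norm_conj.
Qed.

End conjugation.

(** Conjugating [F] on both sides gives a linear map with the same bounds, and the same values on
    the basis because basis vectors are real. *)
Lemma pushes_conj (R : realType) (G H : groupType) (L : G -> nat) (M : H -> nat)
    (sigma tau : nat -> R) (f : G -> H) (F : rapid L sigma -> rapid M tau) :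
  (forall n, 1 <= sigma n) -> (forall n, 1 <= tau n) ->
  pushes f F -> forall a, F (rapid_conj a) = rapid_conj (F a).
Proof.
move=> s1 t1 [[lF bF] Fd] a; rewrite -[LHS]rapid_conjK; congr rapid_conj.
move: a; apply: bounded_linear_ext => // [|g]; last first.
  by rewrite rapid_conj_delta Fd rapid_conj_delta.
split=> [k a b|r].
  by rewrite rapid_conjP lF rapid_conjP conjcK.
have [s [C [C0 FC]]] := bF r; exists s, C; split=> // a.
by rewrite rapid_norm_conj; apply: le_trans (FC _) _; rewrite rapid_norm_conj.
Qed.

Section continuous_composites.
Context (R : realType) (G H : groupType) (L : G -> nat) (M : H -> nat).
Variables (sigma tau : nat -> R).
Hypotheses (sigma1 : forall n, 1 <= sigma n) (tau1 : forall n, 1 <= tau n).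
Variables (F : rapid L sigma -> rapid M tau) (FB : bounded_linear F).

Lemma bounded_linear_conj_continuous : continuous (fun a => rapid_conj (F a)).
Proof.
move=> a; apply: (@continuous_comp _ _ _ F (@rapid_conj R H M tau)).
  exact: bounded_linear_continuous FB a.
exact: continuous_rapid_conj.
Qed.

Lemma bounded_linear_coeff_continuous (h : H) :
  continuous ((fun a => F a h) : rapid L sigma -> R[i]^o).
Proof.
move=> a; apply: (@continuous_comp _ _ _ F (fun b : rapid M tau => b h)).
  exact: bounded_linear_continuous FB a.
exact: continuous_coeff.
Qed.

End continuous_composites.

Lemma pushes_coeff (R : realType) (G H : groupType) (L : G -> nat) (M : H -> nat)
    (sigma tau : nat -> R) (f : G -> H) (f' : H -> G)
    (F : rapid L sigma -> rapid M tau) :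
  (forall n, 1 <= sigma n) -> (forall n, 1 <= tau n) ->
  cancel f f' -> cancel f' f -> pushes f F -> forall a h, F a h = a (f' h).
Proof.
move=> s1 t1 fK f'K [FB Fd] a h.
have idB : bounded_linear (@id (rapid L sigma)).
  by split=> // r; exists r, 1; split=> // b; rewrite mul1r.
(* Both coefficient functionals are compared as multiples of this vector, whose coefficient at the
   identity is 1. *)
pose v := delta L sigma 1%g.
have : F a h *: v = a (f' h) *: v.
  move: a; apply: (@bounded_linear_ext _ _ _ _ _ _ _ s1 s1).
  - exact: (bounded_linear_coeff t1 h v FB).
  - exact: (bounded_linear_coeff s1 (f' h) v idB).
  move=> g; rewrite Fd !coeff_delta; congr ((nat_of_bool _)%:R *: _).
  by apply/eqP/eqP => [->|<-].
move/(congr1 (fun b : rapid L sigma => b 1%g)).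
by rewrite !coeffZ coeff_delta eqxx !mulr1.
Qed.

Lemma group_algebra_linear (R : realType) (G : groupType) (L : G -> nat)
    (sigma : nat -> R) (V : lmodType R[i]) (f : rapid L sigma -> V) a :
  linear f -> group_algebra a ->
  f a = \sum_(g \in [set: G]) a g *: f (delta L sigma g).
Proof.
move=> lf afin; rewrite -(fsbig_widen [set g | a g != 0])//; last first.
  by move=> g [_ /= /negP]; rewrite negbK => /eqP ->; rewrite scale0r.
rewrite fsbig_finite//= -linear_trunc//; congr f; apply: rapidP => g.
rewrite coeff_trunc ?finmap.fset_uniq//.
case: ifPn => // gs; apply/eqP/negPn/negP => ag.
by move: gs; rewrite in_fset_set// notin_setE; apply.
Qed.

(** * The Hopf algebra structure *)

Definition linear_of (K : pzRingType) (U V : lmodType K) (f : U -> V)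
  (lf : linear f) : {linear U -> V} :=
  HB.pack f (GRing.isLinear.Build K U V *:%R f lf).

Definition bilinear_of (K : nzRingType) (U V W : lmodType K) (f : U -> V -> W)
  (bf : bilinear_for *:%R *:%R f) : {bilinear U -> V -> W} :=
  HB.pack f (bilinear_isBilinear.Build K U V W *:%R *:%R f bf).

Lemma bounded_linear_scale (R : realType) (G H : groupType) (L : G -> nat)
    (M : H -> nat) (sigma tau : nat -> R) (f : rapid L sigma -> rapid M tau) k :
  bounded_linear f -> bounded_linear (fun a => k *: f a).
Proof.
move=> [lf bf]; split=> [l a b|r].
  by rewrite lf scalerDr !scalerA mulrC.
have [s [C [C0 fC]]] := bf r; exists s, (normc k * C); split=> [|a].
  by rewrite mulr_ge0 ?normc_ge0.
by rewrite rapid_normZ -mulrA ler_wpM2l ?normc_ge0.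
Qed.

Lemma bounded_bilinear_precomp (R : realType) (G G' H H' K : groupType)
    (L : G -> nat) (L' : G' -> nat) (M : H -> nat) (M' : H' -> nat) (P : K -> nat)
    (sigma sigma' tau tau' ups : nat -> R)
    (b : rapid L' sigma' -> rapid M' tau' -> rapid P ups)
    (f : rapid L sigma -> rapid L' sigma') (f' : rapid M tau -> rapid M' tau') :
  bounded_bilinear b -> bounded_linear f -> bounded_linear f' ->
  bounded_bilinear (fun x y => b (f x) (f' y)).
Proof.
move=> [bl br bB] [lf fB] [lf' f'B]; split=> [y k u v|x k u v|r].
- by rewrite lf bl.
- by rewrite lf' br.
have [s [t [C [C0 bC]]]] := bB r.
have [s' [D [D0 fD]]] := fB s; have [t' [D' [D'0 f'D]]] := f'B t.
exists s', t', (C * D * D'); split=> [|x y]; first by rewrite !mulr_ge0.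
apply: le_trans (bC _ _) _; rewrite (_ : C * D * D' * _ * _ =
  C * ((D * rapid_norm s' x) * (D' * rapid_norm t' y))); last by ring.
by rewrite -mulrA ler_wpM2l// ler_pM ?rapid_norm_ge0.
Qed.

(** The universal property for bounded bilinear maps: the values on basis tensors are prescribed,
    and the identity on all elementary tensors follows by extension in each variable. *)
Lemma tensor_linearize (R : realType) (G H K : groupType) (L : G -> nat)
    (M : H -> nat) (P : K -> nat) (sigma tau ups : nat -> R)
    (sigma1 : forall n, 1 <= sigma n) (tau1 : forall n, 1 <= tau n)
    (ups1 : forall n, 1 <= ups n)
    (b : rapid L sigma -> rapid M tau -> rapid P ups) :
  bounded_bilinear b -> exists F,
    bounded_linear F /\ forall x y, F (rapid_tensor sigma1 tau1 x y) = b x y.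
Proof.
move=> bB; have st1 := tensor_growth_ge1 sigma1 tau1.
have [|F [FB Fd]] := @bounded_linear_extension R _ _ (tensor_length L M) P
    (tensor_growth sigma tau) ups ups1
    (fun x => b (delta L sigma x.1) (delta M tau x.2)).
  move=> r; have [_ _ /(_ r)[s [t [C [C0 bC]]]]] := bB.
  (* With the larger exponent, one power of the product weight dominates both factors. *)
  have q0 : 0 <= Num.max s%:num t%:num by rewrite le_max ge0.
  exists (NngNum q0), C; split=> // -[g h].
  apply: le_trans (bC _ _) _; rewrite -mulrA ler_wpM2l// tensor_weightE//=.
  apply: ler_pM; rewrite ?rapid_norm_ge0//.
    apply: le_trans (rapid_norm_delta _ _ _ _) _.
    by apply: ler_powR => //; rewrite le_max lexx.
  apply: le_trans (rapid_norm_delta _ _ _ _) _.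
  by apply: ler_powR => //; rewrite le_max lexx orbT.
exists F; split=> //; have tB := bounded_rapid_tensor (L := L) (M := M) sigma1 tau1.
apply: bounded_bilinear_ext => //.
- by move=> y; exact: bounded_linear_comp (bounded_bilinear_left y tB) FB.
- by move=> x; exact: bounded_linear_comp (bounded_bilinear_right x tB) FB.
- by move=> y; exact: bounded_bilinear_left.
- by move=> x; exact: bounded_bilinear_right.
- by move=> g h; rewrite rapid_tensor_delta Fd.
Qed.

Section hopf.
Context (R : realType) (G : groupType) (L : G -> nat) (sigma : nat -> R).
Hypothesis sigma1 : forall n, 1 <= sigma n.
Local Notation A := (rapid L sigma).
Local Notation L2 := (tensor_length L L).
Local Notation sigma2 := (tensor_growth sigma sigma).
Local Notation T := (rapid L2 sigma2).
Hypothesis tame_mul : tame L2 L sigma2 sigma (fun x : G * G => (x.1 * x.2)%g).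
Hypothesis tame_inv : tame L L sigma sigma (fun g : G => (g^-1)%g).
Let sigma21 : forall n, 1 <= sigma2 n := tensor_growth_ge1 sigma1 sigma1.
Let t := rapid_tensor sigma1 sigma1 : A -> A -> T.
Let AA : cptensor A A := rapid_cptensor L L sigma1 sigma1.
Local Notation d := (delta L sigma).

Let td g h : t (d g) (d h) = delta L2 sigma2 (g, h).
Proof. exact: rapid_tensor_delta. Qed.

Let tB : bounded_bilinear t := bounded_rapid_tensor sigma1 sigma1.

Let tl b : bounded_linear (t^~ b).
Proof. exact: bounded_bilinear_left. Qed.

Let tr a : bounded_linear (t a).
Proof. exact: bounded_bilinear_right. Qed.

Section structure_maps.
(** [m] is the linearized product, [D] the coproduct, [S] the antipode, and [E] the counit followed
    by the unit. *)
Variables (m : T -> A) (D : A -> T) (E S : A -> A).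
Hypotheses (mP : pushes (fun x : G * G => (x.1 * x.2)%g) m).
Hypotheses (DP : pushes (fun g : G => (g, g)) D).
Hypotheses (EP : pushes (fun=> 1%g : G) E) (SP : pushes (fun g : G => (g^-1)%g) S).

Let mul a b := m (t a b).
Let star a := rapid_conj (S a).
Let counit a : R[i] := E a 1%g.

Let mulB : bounded_bilinear mul.
Proof. exact: bounded_bilinear_comp tB mP.1. Qed.

Let mull b : bounded_linear (mul^~ b).
Proof. exact: bounded_bilinear_left. Qed.

Let mulr a : bounded_linear (mul a).
Proof. exact: bounded_bilinear_right. Qed.

Let muld g h : mul (d g) (d h) = d (g * h)%g.
Proof. by rewrite /mul td mP.2. Qed.

Let mulA a b c : mul (mul a b) c = mul a (mul b c).
Proof.
move: a b; apply: bounded_bilinear_ext => //.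
- by move=> b; exact: bounded_linear_comp (mull b) (mull c).
- by move=> a; exact: bounded_linear_comp (mulr a) (mull c).
- by move=> a; exact: bounded_linear_comp (mull c) (mulr a).
move=> g h; move: c; apply: bounded_linear_ext => //.
  exact: bounded_linear_comp (mulr _) (mulr _).
by move=> k; rewrite !muld mulgA.
Qed.

Let bounded_id : bounded_linear (@id A).
Proof. by split=> // r; exists r, 1; split=> // a; rewrite mul1r. Qed.

Let mul1 a : mul (d 1%g) a = a /\ mul a (d 1%g) = a.
Proof.
split; move: a; apply: bounded_linear_ext => // g.
  by rewrite muld mul1g.
by rewrite muld mulg1.
Qed.

Let counitE a : E a = counit a *: d 1%g.
Proof.
move: a; apply: bounded_linear_ext => //; first exact: EP.1.
  exact: bounded_linear_coeff EP.1.
by move=> g; rewrite /counit EP.2 coeff_delta eqxx scale1r.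
Qed.

(** Transfers a scalar identity to one in [A], where comparison on the basis is available. *)
Let counit_inj a (k : R[i]) : E a = k *: d 1%g -> counit a = k.
Proof. by move=> Ea; rewrite /counit Ea coeffZ coeff_delta eqxx mulr1. Qed.

Let counit_scale (v : A) : bounded_linear (fun a => counit a *: v).
Proof. exact: bounded_linear_coeff EP.1. Qed.

Let counitd g : counit (d g) = 1.
Proof. by rewrite /counit EP.2 coeff_delta eqxx. Qed.

Let counit_mul a b : counit (mul a b) = counit a * counit b.
Proof.
apply: counit_inj; rewrite -scalerA -counitE; move: a b.
apply: bounded_bilinear_ext => //.
- by move=> b; exact: bounded_linear_comp (mull b) EP.1.
- by move=> a; exact: bounded_linear_comp (mulr a) EP.1.
- by move=> a; exact: bounded_linear_scale EP.1.
- by move=> g h; rewrite muld !EP.2 counitd scale1r.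
Qed.

Let SK a : S (S a) = a.
Proof.
move: a; apply: (bounded_linear_ext sigma1 sigma1 _ bounded_id).
  exact: bounded_linear_comp SP.1 SP.1.
by move=> g; rewrite /= !SP.2 invgK.
Qed.

Let S_mul a b : S (mul a b) = mul (S b) (S a).
Proof.
move: a b; apply: bounded_bilinear_ext => //.
- by move=> b; exact: bounded_linear_comp (mull b) SP.1.
- by move=> a; exact: bounded_linear_comp (mulr a) SP.1.
- by move=> b; exact: bounded_linear_comp SP.1 (mulr _).
- by move=> a; exact: bounded_linear_comp SP.1 (mull _).
- by move=> g h; rewrite muld !SP.2 muld invgM.
Qed.

Let S_conj a : S (rapid_conj a) = rapid_conj (S a).
Proof. exact: pushes_conj SP a. Qed.

Let t_conj a b : rapid_conj (t a b) = t (rapid_conj a) (rapid_conj b).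
Proof. by apply: rapidP => x; rewrite coeff_conj !coeff_tensor rmorphM. Qed.

Let starK : involutive star.
Proof. by move=> a; rewrite /star S_conj rapid_conjK SK. Qed.

Let star_mul a b : star (mul a b) = mul (star b) (star a).
Proof.
rewrite /star S_mul /mul -t_conj.
by rewrite (pushes_conj sigma21 sigma1 mP).
Qed.

Let star_conj_linear : conj_linear star.
Proof. by move=> k a b; rewrite /star SP.1.1 rapid_conjP. Qed.

Let S_coeff a g : S a g = a (g^-1)%g.
Proof. by apply: (pushes_coeff sigma1 sigma1 _ _ SP); exact: invgK. Qed.

Let counit_S a : counit (S a) = counit a.
Proof.
apply: counit_inj; rewrite -counitE; move: a; apply: bounded_linear_ext => //.
- exact: bounded_linear_comp SP.1 EP.1.
- exact: EP.1.
- by move=> g; rewrite /= SP.2 !EP.2.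
Qed.

Let counit_star a : counit (star a) = conjc (counit a).
Proof.
by rewrite /star /counit (pushes_conj sigma1 sigma1 EP) coeff_conj [E _ _]counit_S.
Qed.

Let S_star a : S (star (S (star a))) = a.
Proof. by rewrite /star !S_conj !SK rapid_conjK. Qed.

Let linearizesP (H K M : groupType) (LH : H -> nat) (LK : K -> nat) (LM : M -> nat)
    (tau ups rho : nat -> R) (tau1 : forall n, 1 <= tau n)
    (ups1 : forall n, 1 <= ups n) (rho1 : forall n, 1 <= rho n)
    (f : rapid LH tau -> rapid LK ups -> rapid LM rho) F :
  bounded_linear F ->
  (forall x y, F (rapid_tensor tau1 ups1 x y) = f x y) ->
  linearizes (T := rapid_cptensor LH LK tau1 ups1) f F.
Proof.
move=> FB Ff; split=> //; first exact: FB.1.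
by apply: bounded_linear_continuous FB => //; exact: tensor_growth_ge1.
Qed.

Let comulA : exists (AA_A : cptensor AA A) (A_AA : cptensor A AA)
    (comul_id : AA -> AA_A) (id_comul : AA -> A_AA) (assoc : AA_A -> A_AA),
  [/\ linearizes (fun x y => tens AA_A (D x) y) comul_id,
      linearizes (fun x y => tens A_AA x (D y)) id_comul,
      linear assoc /\ continuous assoc,
      forall x y z, assoc (tens AA_A (tens AA x y) z) =
                    tens A_AA x (tens AA y z) &
      forall a, assoc (comul_id (D a)) = id_comul (D a)].
Proof.
have s21 := tensor_growth_ge1 sigma21 sigma1.
have s12 := tensor_growth_ge1 sigma1 sigma21.
pose t21 := rapid_tensor sigma21 sigma1 : T -> A -> _.
pose t12 := rapid_tensor sigma1 sigma21 : A -> T -> _.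
have t21B : bounded_bilinear t21 := bounded_rapid_tensor sigma21 sigma1.
have t12B : bounded_bilinear t12 := bounded_rapid_tensor sigma1 sigma21.
have DidB : bounded_bilinear (fun x y => t21 (D x) y).
  exact: (bounded_bilinear_precomp t21B DP.1 bounded_id).
have idDB : bounded_bilinear (fun x y => t12 x (D y)).
  exact: (bounded_bilinear_precomp t12B bounded_id DP.1).
have [F [FB FE]] := tensor_linearize sigma1 sigma1 s21 DidB.
have [F' [F'B F'E]] := tensor_linearize sigma1 sigma1 s12 idDB.
(* The associator is the push-forward along the rebracketing of triples, which is tame as it is
   built from projections and pairings. *)
have [|As AsP] := @pushforward R _ _ (tensor_length L2 L) (tensor_length L L2)
    (tensor_growth sigma2 sigma) (tensor_growth sigma sigma2) s12
    (fun x => (x.1.1, (x.1.2, x.2))).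
  have f1 := tame_fst L2 L sigma21 sigma1.
  apply: (tame_pair s21 sigma1 sigma21).
    exact: (tame_comp sigma21 f1 (tame_fst L L sigma1 sigma1)).
  apply: (tame_pair s21 sigma1 sigma1); last exact: tame_snd.
  exact: (tame_comp sigma21 f1 (tame_snd L L sigma1 sigma1)).
exists (rapid_cptensor L2 L sigma21 sigma1), (rapid_cptensor L L2 sigma1 sigma21).
exists F, F', As; split.
- exact: linearizesP.
- exact: linearizesP.
- split; first exact: AsP.1.1.
  exact: bounded_linear_continuous AsP.1.
- move=> x y z; move: x y; rewrite -/(forall x y, As (t21 (t x y) z) = t12 x (t y z)).
  apply: bounded_bilinear_ext => //.
  + move=> y; apply: bounded_linear_comp AsP.1.
    exact: bounded_linear_comp (tl y) (bounded_bilinear_left z t21B).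
  + move=> x; apply: bounded_linear_comp AsP.1.
    exact: bounded_linear_comp (tr x) (bounded_bilinear_left z t21B).
  + by move=> y; exact: bounded_bilinear_left.
  + by move=> x; exact: bounded_linear_comp (tl z) (bounded_bilinear_right x t12B).
  move=> g h; move: z; apply: bounded_linear_ext => //.
  + exact: bounded_linear_comp (bounded_bilinear_right _ t21B) AsP.1.
  + exact: bounded_linear_comp (tr _) (bounded_bilinear_right _ t12B).
  by move=> k; rewrite !td /t21 /t12 !rapid_tensor_delta AsP.2.
apply: bounded_linear_ext => //.
- exact: bounded_linear_comp (bounded_linear_comp DP.1 FB) AsP.1.
- exact: bounded_linear_comp DP.1 F'B.
move=> g; rewrite /= DP.2 -td FE F'E /t21 /t12 DP.2.
by rewrite !rapid_tensor_delta AsP.2.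
Qed.

Let counit_scale_bilinear : bounded_bilinear (fun x y : A => counit x *: y).
Proof.
split=> [y|x|r].
- exact: (counit_scale y).1.
- by move=> k u v; rewrite scalerDr !scalerA mulrC.
have [s [C [C0 EC]]] := EP.1.2 0%:nng; exists s, r, C; split=> // x y.
rewrite rapid_normZ ler_wpM2r ?rapid_norm_ge0//.
exact: le_trans (normc_coeff_le sigma1 _ _ _) (EC _).
Qed.

Let counit_scale_bilinear' : bounded_bilinear (fun x y : A => counit y *: x).
Proof.
have [lx ly bxy] := counit_scale_bilinear; split=> [y|x|r].
- exact: ly.
- exact: lx.
have [s [s' [C [C0 fC]]]] := bxy r; exists s', s, C; split=> // x y.
by rewrite mulrAC.
Qed.

Let comul_counit : exists counit_id id_counit : AA -> A,
  [/\ linearizes (fun x y => counit x *: y) counit_id,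
      linearizes (fun x y => counit y *: x) id_counit &
      forall a, counit_id (D a) = a /\ id_counit (D a) = a].
Proof.
have [F [FB FE]] := tensor_linearize sigma1 sigma1 sigma1 counit_scale_bilinear.
have [F' [F'B F'E]] := tensor_linearize sigma1 sigma1 sigma1 counit_scale_bilinear'.
exists F, F'; split; [exact: linearizesP|exact: linearizesP|split].
  move: a; apply: (bounded_linear_ext sigma1 sigma1 _ bounded_id).
    exact: bounded_linear_comp DP.1 FB.
  by move=> g; rewrite /= DP.2 -td FE counitd scale1r.
move: a; apply: (bounded_linear_ext sigma1 sigma1 _ bounded_id).
  exact: bounded_linear_comp DP.1 F'B.
by move=> g; rewrite /= DP.2 -td F'E counitd scale1r.
Qed.

Let comul_mul : exists mulAA : {bilinear AA -> AA -> AA},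
  [/\ jointly_continuous mulAA,
      forall x y x' y', mulAA (tens AA x y) (tens AA x' y') =
                        tens AA (mul x x') (mul y y') &
      forall a b, D (mul a b) = mulAA (D a) (D b)].
Proof.
pose tT := rapid_tensor sigma21 sigma21 : T -> T -> _.
have tTB : bounded_bilinear tT := bounded_rapid_tensor sigma21 sigma21.
have s22 := tensor_growth_ge1 sigma21 sigma21.
(* The product of [AA] is induced by componentwise multiplication of pairs in the direct product of
   the group with itself. *)
have [|F FP] := @pushforward R _ _ (tensor_length L2 L2) L2
    (tensor_growth sigma2 sigma2) sigma2 sigma21
    (fun x => ((x.1.1 * x.2.1)%g, (x.1.2 * x.2.2)%g)).
  have f1 := tame_fst L2 L2 sigma21 sigma21; have f2 := tame_snd L2 L2 sigma21 sigma21.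
  have g1 := tame_fst L L sigma1 sigma1; have g2 := tame_snd L L sigma1 sigma1.
  have h1 := tame_pair s22 sigma1 sigma1
    (tame_comp sigma21 f1 g1) (tame_comp sigma21 f2 g1).
  have h2 := tame_pair s22 sigma1 sigma1
    (tame_comp sigma21 f1 g2) (tame_comp sigma21 f2 g2).
  exact: (tame_pair s22 sigma1 sigma1
    (tame_comp sigma21 h1 tame_mul) (tame_comp sigma21 h2 tame_mul)).
pose mT z w := F (tT z w); have mTB : bounded_bilinear mT.
  exact: bounded_bilinear_comp tTB FP.1.
have mTl w : bounded_linear (mT^~ w) by exact: bounded_bilinear_left.
have mTr z : bounded_linear (mT z) by exact: bounded_bilinear_right.
have mTd x y : mT (delta L2 sigma2 x) (delta L2 sigma2 y) =
    delta L2 sigma2 ((x.1 * y.1)%g, (x.2 * y.2)%g).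
  by rewrite /mT /tT rapid_tensor_delta FP.2.
have [mTlin mTlin' _] := mTB.
exists (bilinear_of (mTlin, mTlin') : {bilinear T -> T -> T}); split.
- exact: (bounded_bilinear_continuous sigma21 sigma21 sigma21 mTB).
- move=> x y x' y'.
  rewrite -[LHS]/(mT (t x y) (t x' y')) -[RHS]/(t (mul x x') (mul y y')).
  move: x y; apply: bounded_bilinear_ext => //.
  + by move=> y; exact: bounded_linear_comp (tl y) (mTl _).
  + by move=> x; exact: bounded_linear_comp (tr x) (mTl _).
  + by move=> y; exact: bounded_linear_comp (mull _) (tl _).
  + by move=> x; exact: bounded_linear_comp (mull _) (tr _).
  move=> g h; move: x' y'; apply: bounded_bilinear_ext => //.
  + by move=> y; exact: bounded_linear_comp (tl y) (mTr _).
  + by move=> x; exact: bounded_linear_comp (tr x) (mTr _).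
  + by move=> y; exact: bounded_linear_comp (mulr _) (tl _).
  + by move=> x; exact: bounded_linear_comp (mulr _) (tr _).
  by move=> g' h'; rewrite !muld !td mTd.
move=> a b; rewrite -[RHS]/(mT (D a) (D b)).
move: a b; apply: bounded_bilinear_ext => //.
- by move=> b; exact: bounded_linear_comp (mull b) DP.1.
- by move=> a; exact: bounded_linear_comp (mulr a) DP.1.
- by move=> b; exact: bounded_linear_comp DP.1 (mTl _).
- by move=> a; exact: bounded_linear_comp DP.1 (mTr _).
- by move=> g h; rewrite muld !DP.2 mTd.
Qed.

Let antipode_ex : exists (mulL : AA -> A) (antipode_id id_antipode : AA -> AA),
  [/\ linearizes (T := AA) mul mulL,
      linearizes (fun x y => tens AA (S x) y) antipode_id,
      linearizes (fun x y => tens AA x (S y)) id_antipode,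
      forall a, mulL (antipode_id (D a)) = counit a *: d 1%g &
      forall a, mulL (id_antipode (D a)) = counit a *: d 1%g].
Proof.
have SidB := bounded_bilinear_precomp tB SP.1 bounded_id.
have idSB := bounded_bilinear_precomp tB bounded_id SP.1.
have [F [FB FE]] := tensor_linearize sigma1 sigma1 sigma21 SidB.
have [F' [F'B F'E]] := tensor_linearize sigma1 sigma1 sigma21 idSB.
exists m, F, F'; split.
- by apply: linearizesP => //; exact: mP.1.
- exact: linearizesP.
- exact: linearizesP.
- move=> a; rewrite -counitE; move: a; apply: bounded_linear_ext => //.
  + exact: bounded_linear_comp (bounded_linear_comp DP.1 FB) mP.1.
  + exact: EP.1.
  by move=> g; rewrite /= DP.2 -td FE SP.2 td mP.2 EP.2 mulVg.
- move=> a; rewrite -counitE; move: a; apply: bounded_linear_ext => //.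
  + exact: bounded_linear_comp (bounded_linear_comp DP.1 F'B) mP.1.
  + exact: EP.1.
  by move=> g; rewrite /= DP.2 -td F'E SP.2 td mP.2 EP.2 mulgV.
Qed.

Let comul_star : exists starAA : AA -> AA,
  [/\ conj_linear starAA, continuous starAA,
      forall x y, starAA (tens AA x y) = tens AA (star x) (star y) &
      forall a, D (star a) = starAA (D a)].
Proof.
have SSB := bounded_bilinear_precomp tB SP.1 SP.1.
have [F [FB FE]] := tensor_linearize sigma1 sigma1 sigma21 SSB.
(* Conjugate linear maps cannot be linearized directly; the linear map [S] ⊗ [S] can, and
   conjugation is applied afterwards. *)
exists (fun z => rapid_conj (F z)); split.
- by move=> k x y; rewrite FB.1 rapid_conjP.
- exact: (bounded_linear_conj_continuous sigma21 sigma21 FB).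
- by move=> x y; rewrite [F _]FE t_conj.
move=> a; rewrite /star (pushes_conj sigma1 sigma21 DP); congr rapid_conj.
move: a; apply: bounded_linear_ext => //.
- exact: bounded_linear_comp SP.1 DP.1.
- exact: bounded_linear_comp DP.1 FB.
- by move=> g; rewrite /= SP.2 !DP.2 -!td FE SP.2.
Qed.

Lemma hopf_star_of_pushes : exists H : hopf_star_maps AA,
  frechet_hopf_star H /\ extends_group_algebra H.
Proof.
have [mlin mlin' _] := mulB.
pose hm : {bilinear A -> A -> A} := bilinear_of (mlin, mlin').
pose hS : {linear A -> A} := linear_of SP.1.1.
have counit_linear : linear (counit : A -> R[i]^o).
  by move=> k a b; rewrite /counit EP.1.1.
pose he : {scalar A} := linear_of counit_linear.
pose hD : {linear A -> AA} := linear_of DP.1.1.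
have S_cont : continuous S by exact: bounded_linear_continuous SP.1.
have counit_cont : continuous (counit : A -> R[i]^o).
  exact: (bounded_linear_coeff_continuous sigma1 sigma1 EP.1).
exists (HopfStarMaps hm (d 1%g) star hS he hD); split; split.
- exact: rapid_frechet.
- exact: (bounded_bilinear_continuous sigma1 sigma1 sigma1 mulB).
- exact: (bounded_linear_conj_continuous sigma1 sigma1 SP.1).
- exact: S_cont.
- exact: counit_cont.
- exact: (bounded_linear_continuous sigma1 sigma21 DP.1).
- exact: mulA.
- exact: mul1.
- exact: comulA.
- exact: comul_counit.
- exact: comul_mul.
- by rewrite -[LHS]/(D (d 1%g)) DP.2 -td.
- exact: counit_mul.
- exact: counitd.
- exact: antipode_ex.
- exact: star_conj_linear.
- exact: starK.
- exact: star_mul.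
- exact: comul_star.
- exact: counit_star.
- exact: S_star.
- exact: muld.
- by [].
- by move=> a _ g; rewrite -[LHS]/(conjc (S a g)) S_coeff.
- by move=> a _ g; exact: S_coeff.
- move=> a afin; rewrite -[LHS]/(counit a).
  rewrite (group_algebra_linear counit_linear afin); apply: eq_fsbigr => g _.
  by rewrite counitd; exact: mulr1.
- move=> a afin; rewrite -[LHS]/(D a) (group_algebra_linear DP.1.1 afin).
  by apply: eq_fsbigr => g _; rewrite DP.2 -td.
Qed.

End structure_maps.

Lemma hopf_star : exists (AA : cptensor A A) (H : hopf_star_maps AA),
  frechet_hopf_star H /\ extends_group_algebra H.
Proof.
have [m mP] := pushforward sigma1 tame_mul.
have [D DP] := pushforward sigma21
  (tame_pair sigma1 sigma1 sigma1 (tame_id L sigma1) (tame_id L sigma1)).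
have [E EP] := pushforward (L := L) (sigma := sigma) sigma1
  (tame_const L L sigma sigma1 1%g).
have [S SP] := pushforward sigma1 tame_inv.
by exists AA; exact: hopf_star_of_pushes mP DP EP SP.
Qed.

End hopf.

(** * Word lengths and growth *)

Section word_lengths.
Context (G : groupType).
Implicit Types (S w : seq G) (g h : G) (L : G -> nat).

Lemma is_word_cat S w w' g h :
  is_word S w g -> is_word S w' h -> is_word S (w ++ w') (g * h)%g.
Proof.
move=> [wS <-] [w'S <-]; split; last by rewrite big_cat.
by move=> x; rewrite mem_cat => /orP[/wS|/w'S].
Qed.

Lemma is_word_inv S w g : (forall x, x \in S -> (x^-1)%g \in S) ->
  is_word S w g -> is_word S (rev [seq (x^-1)%g | x <- w]) (g^-1)%g.
Proof.
move=> SV [wS <-]; split=> [x|].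
  by rewrite mem_rev => /mapP[y /wS yS ->]; exact: SV.
elim: w {wS} => [|x w ih]; first by rewrite !big_nil invg1.
by rewrite [in RHS]big_cons invgM /= rev_cons -cats1 big_cat/= big_seq1 ih.
Qed.

Lemma word_length_mul L g h : is_word_length L -> (L (g * h)%g <= L g + L h)%N.
Proof.
move=> [S [_ _ LS]]; have [[w wg <-] _] := LS g; have [[w' wh <-] _] := LS h.
by rewrite -size_cat; apply: (LS _).2; exact: is_word_cat.
Qed.

Lemma word_length_inv L g : is_word_length L -> (L (g^-1)%g <= L g)%N.
Proof.
move=> [S [SV _ LS]]; have [[w wg <-] _] := LS g.
rewrite -(size_map (fun x => (x^-1)%g)) -size_rev.
by apply: (LS _).2; exact: is_word_inv.
Qed.

(** Every letter of a shortest word over [S'] has [L]-length at most the sum of [L] over [S'], and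
    [L] is subadditive. *)
Lemma word_length_equiv L L' : is_word_length L -> is_word_length L' ->
  exists k, forall g, (L g <= k * L' g)%N.
Proof.
move=> LP [S' [_ _ L'S]]; exists (\sum_(x <- S') L x)%N => g.
have [[w [wS' <-] <-] _] := L'S g.
elim: w wS' => [|x w ih] wS'.
  rewrite big_nil; have [S [_ _ LS]] := LP.
  by apply: leq_trans ((LS _).2 [::] _) _ => //; split; rewrite ?big_nil.
rewrite big_cons mulnS; apply: leq_trans (word_length_mul _ _ LP) _.
apply: leq_add; last by apply: ih => y yw; apply: wS'; rewrite inE yw orbT.
have xS' : x \in S' by apply: wS'; rewrite inE eqxx.
by rewrite (big_rem x)//= leq_addr.
Qed.

End word_lengths.

(** * Growth estimates and tameness for word lengths *)

Section growth_bounds.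
Context (R : realType) (G : groupType) (sigma : nat -> R).
Hypothesis sigma_growth : growth_function sigma.
Hypothesis sigma_asm : almost_submultiplicative sigma.

Lemma growth_ge1 n : 1 <= sigma n.
Proof. by have [s1 _ _] := sigma_growth. Qed.

Lemma growth_homo n m : (n <= m)%N -> sigma n <= sigma m.
Proof.
by have [_ sS _] := sigma_growth; apply: (homo_leq (@lexx _ _) le_trans).
Qed.

(** Induction on [k] by almost submultiplicativity with epsilon 1: one more summand turns the
    exponent p into 2 + 2p and the constant C into c C^2. The size of the exponent does not matter,
    since all exponents occur among the norms. *)
Lemma growth_mul k : exists (p : {nonneg R}) (C : R), 0 <= C /\
  forall n, sigma (k * n)%N <= C * sigma n `^ p%:num.
Proof.
have s0 n : 0 <= sigma n := le_trans ler01 (growth_ge1 n).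
have [c c0 sc] := sigma_asm ltr01.
elim: k => [|k [p [C [C0 pC]]]].
  by exists 0%:nng, (sigma 0%N); split=> // n; rewrite powRr0 mulr1.
exists (1 + 1 + p%:num * (1 + 1))%:nng, (c * C `^ (1 + 1)).
split=> [|n]; first by rewrite mulr_ge0 ?powR_ge0// ltW.
rewrite mulSn; apply: le_trans (sc _ _) _ => /=.
rewrite (@powRD _ _ (1 + 1) (p%:num * (1 + 1))); last first.
  by rewrite [_ != 0]lt0r_neq0 ?implybT// (lt_le_trans ltr01)// growth_ge1.
rewrite powRrM -!mulrA ler_wpM2l ?(ltW c0)// mulrCA ler_wpM2l ?powR_ge0//.
rewrite -powRM ?powR_ge0//; apply: ge0_ler_powR => //.
- by rewrite nnegrE.
- by rewrite nnegrE mulr_ge0 ?powR_ge0.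
Qed.

Variable L : G -> nat.
Hypothesis LP : is_word_length L.

Lemma tame_word_mul : tame (tensor_length L L) L (tensor_growth sigma sigma) sigma
  (fun x : G * G => (x.1 * x.2)%g).
Proof.
have s0 n : 0 <= sigma n := le_trans ler01 (growth_ge1 n).
have [c c0 sc] := sigma_asm ltr01.
exists (1 + 1)%:nng, c; split=> [|[g h]]; first exact: ltW.
rewrite tensor_growthE/= powRM// mulrA; apply: le_trans (sc _ _).
by apply: growth_homo; exact: word_length_mul.
Qed.

Lemma tame_word_inv : tame L L sigma sigma (fun g : G => (g^-1)%g).
Proof.
exists 1%:nng, 1; split=> // g.
rewrite mul1r powRr1 ?(le_trans ler01 (growth_ge1 _))//.
by apply: growth_homo; exact: word_length_inv.
Qed.

Lemma tame_word_id (L' : G -> nat) : is_word_length L' ->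
  tame L' L sigma sigma (@id G).
Proof.
move=> L'P; have [k kP] := word_length_equiv LP L'P.
have [p [C [C0 pC]]] := growth_mul k; exists p, C; split=> // g.
exact: le_trans (growth_homo (kP g)) (pC _).
Qed.

End growth_bounds.

(** The push-forward along the identity keeps every coefficient, so it is the inclusion, and open
    sets are pulled back along it. *)
Lemma rapid_tame_id (R : realType) (G : groupType) (L L' : G -> nat)
    (sigma : nat -> R) : (forall n, 1 <= sigma n) -> tame L' L sigma sigma (@id G) ->
  rapid_set L' sigma `<=` rapid_set L sigma /\
  forall U : set (G -> R[i]^o),
    open [set a : rapid L sigma | U a] -> open [set a : rapid L' sigma | U a].
Proof.
move=> s1 /(pushforward s1)[F FP].
have FE a : coeff (F a) = coeff a.
  by apply/funext => g; apply: (pushes_coeff s1 s1 _ _ FP).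
split=> [a aL'|U oU].
  have aP : a \in rapid_pred L' sigma by rewrite inE.
  by have := coeffP (F (Rapid aP)); rewrite FE inE.
rewrite [X in open X](_ : _ = F @^-1` [set a : rapid L sigma | U a]).
  apply: open_comp oU => a _.
  exact: (bounded_linear_continuous s1 s1 FP.1).
by apply/seteqP; split=> a /=; rewrite FE.
Qed.

(** * Submultiplicativity of the norms *)

Section submultiplicative.
Context (R : realType) (G : groupType) (L : G -> nat) (sigma : nat -> R).
Hypothesis sigma1 : forall n, 1 <= sigma n.
Local Notation A := (rapid L sigma).
Implicit Types (a b : A) (r : {nonneg R}).

(** A norm composed with [f] is a seminorm whose unit ball is a neighbourhood of 0. This makes an
    arbitrary continuous product, known only on the basis, accessible to the estimates for bounded
    maps. *)
Lemma linear_continuous_bounded (f : A -> A) :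
  linear f -> {for 0, continuous f} -> bounded_linear f.
Proof.
move=> lf cf; split=> // r.
have f0 : f 0 = 0 by have := zmod_morphism_linear lf 0 0; rewrite !subrr.
have [||s [C [C0 fC]]] := @seminorm_bound _ _ L _ sigma1 (fun a => rapid_norm r (f a)).
- split=> [a b|k a].
    by have := lf 1 a b; rewrite !scale1r => ->; exact: rapid_normD.
  by rewrite (scalable_linear lf) rapid_normZ.
- apply: (cf [set a | rapid_norm r a < 1]); rewrite f0; apply/(rapid_nbhsP sigma1).
  by exists r, 1; split=> // b; rewrite subr0.
by exists s, C; split=> //; exact: ltW.
Qed.

Lemma rapid_norm_mul (mul : {bilinear A -> A -> A}) r a b :
  jointly_continuous mul ->
  (forall g h, mul (delta L sigma g) (delta L sigma h) = delta L sigma (g * h)%g) ->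
  (forall g h, sigma (L (g * h)%g) <= sigma (L g) * sigma (L h)) ->
  rapid_norm r (mul a b) <= rapid_norm r a * rapid_norm r b.
Proof.
move=> mul_cont muld sM.
have s0 n : 0 <= sigma n := le_trans ler01 (sigma1 n).
have mull y : bounded_linear (mul^~ y).
  apply: linear_continuous_bounded => [k u v|U mU].
    by rewrite linearPl.
  have [[V W] [/= V0 Wy VW]] := mul_cont (0, y) U mU.
  apply: (filterS _ V0) => x Vx; apply: (VW (x, y)); split=> //=.
  exact: nbhs_singleton.
have mulr x : bounded_linear (mul x).
  apply: linear_continuous_bounded => [k u v|U mU].
    by rewrite linearPr.
  have [[V W] [/= Vx W0 VW]] := mul_cont (x, 0) U mU.
  apply: (filterS _ W0) => y Wy; apply: (VW (x, y)); split=> //=.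
  exact: nbhs_singleton.
(* The left factor is reduced to a basis vector with the norm of [b] as constant, then the right one
   with the weight of [g] as constant; neither reduction loses a factor. *)
rewrite mulrC; apply: (bounded_linear_bound (mull b)) => [|g].
  exact: rapid_norm_ge0.
rewrite mulrC; apply: (bounded_linear_bound (mulr _)) => [|h].
  exact: powR_ge0.
rewrite muld; apply: le_trans (rapid_norm_delta _ _ _ _) _.
by rewrite -powRM//; apply: ge0_ler_powR => //; rewrite nnegrE ?mulr_ge0.
Qed.

End submultiplicative.

Theorem proposition4p4 (R : realType) (G : groupType) (sigma : nat -> R)
    (G_fg : finitely_generated G) (sigma_growth : growth_function sigma)
    (sigma_asm : almost_submultiplicative sigma) :
  (forall L L' : G -> nat, is_word_length L -> is_word_length L' ->
    rapid_set L sigma = rapid_set L' sigma /\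
    forall U : set (G -> R[i]^o),
      open [set a : rapid L sigma | U a] <-> open [set a : rapid L' sigma | U a])
  /\
  (forall L : G -> nat, is_word_length L ->
    dense (@group_algebra R G L sigma) /\
    exists (AA : cptensor (rapid L sigma) (rapid L sigma))
        (H : hopf_star_maps AA),
      frechet_hopf_star H /\ extends_group_algebra H)
  /\
  (submultiplicative sigma ->
   forall L : G -> nat, is_word_length L ->
   forall mul : {bilinear rapid L sigma -> rapid L sigma -> rapid L sigma},
    jointly_continuous mul ->
    (forall g h, mul (delta L sigma g) (delta L sigma h) =
                 delta L sigma (g * h)%g) ->
    (forall r : R, 0 <= r -> forall a b : rapid L sigma,
       (wnorm L sigma r (mul a b) <= wnorm L sigma r a * wnorm L sigma r b)%E) /\
    locally_m_convex mul).
Proof.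
have s1 := growth_ge1 sigma_growth; split; last split.
- move=> L L' LP L'P.
  have [LL' oLL'] := rapid_tame_id s1 (tame_word_id sigma_growth sigma_asm L'P LP).
  have [L'L oL'L] := rapid_tame_id s1 (tame_word_id sigma_growth sigma_asm LP L'P).
  by split; [apply/seteqP|split; [exact: oL'L|exact: oLL']].
- move=> L LP; split; first exact: group_algebra_dense.
  apply: (hopf_star s1); first exact: tame_word_mul.
  exact: tame_word_inv.
move=> sM L LP mul mul_cont muld.
have mul_le r a b : rapid_norm r (mul a b) <= rapid_norm r a * rapid_norm r b.
  apply: rapid_norm_mul => // g h; apply: le_trans (sM _ _).
  by apply: growth_homo => //; exact: word_length_mul.
split=> [r r0 a b|].
  by have := mul_le (NngNum r0) a b; rewrite -lee_fin EFinM !rapid_normE.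
exists {nonneg R}, (@rapid_norm R G L sigma); split=> //.
  by move=> r; exact: rapid_norm_seminorm.
move=> U; split=> [/nbhs_rapid|] [rs [e [e0 eU]]].
  by exists rs, e; split=> // a ae; apply: eU; rewrite subr0.
by apply/nbhs_rapid; exists rs, e; split=> // a; rewrite subr0 => /eU.
Qed.
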